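(* Let $(\mathcal F,\Omega_{\mathcal F})$ be a symplectic foliation of a manifold $Z$. A polarization $\mathbf T$ of $(\mathcal F,\Omega_{\mathcal F})$ defines a polarization of each symplectic leaf: for every leaf $i_F:F\to Z$ with symplectic form $\Omega_F=i_F^*\Omega_{\mathcal F}$, the restriction $\mathbf T_F=i_F^*\mathbf T\subset i_F^*T\mathcal F=TF$ is a polarization of the symplectic manifold $(F,\Omega_F)$.
   Context: Manifolds are smooth, Hausdorff, second-countable and connected. A foliation $\mathcal F$ of $Z$ consists of the maximal integral manifolds (leaves) of an involutive distribution $T\mathcal F\subset TZ$. A symplectic foliation carries a non-degenerate leafwise two-form $\Omega_{\mathcal F}$ (section of $\bigwedge^2T\mathcal F^*$) closed under the leafwise exterior differential (de Rham differential along $T\mathcal F$). A polarization of a symplectic foliation $(\mathcal F,\Omega_{\mathcal F})$ is a maximal (regular) involutive distribution $\mathbf T\subset T\mathcal F$ on $Z$ such that $\Omega_{\mathcal F}(u,v)=0$ for all $u,v\in\mathbf T_z$, $z\in Z$. A polarization of a symplectic manifold $(F,\Omega_F)$ is the same notion applied to the foliation of $F$ with the single leaf $F$. *)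

(* Defs.v *)
From HB Require Import structures.
From mathcomp Require Import all_boot all_order all_algebra.
From mathcomp Require Import all_classical all_reals.
From mathcomp Require Import topology normedtype landau derive.

Set Implicit Arguments.
Unset Strict Implicit.
Unset Printing Implicit Defensive.

Import Order.TTheory GRing.Theory Num.Theory.
Import numFieldNormedType.Exports.

Local Open Scope classical_set_scope.
Local Open Scope ring_scope.

(* Meant for open U only: all the conditions are local, so the values of f
   outside U are irrelevant. *)
Fixpoint Ck_on (R : realType) (V W : normedModType R) (k : nat)
    (U : set V) (f : V -> W) : Prop :=
  match k with
  | 0 => forall x, U x -> {for x, continuous f}
  | k'.+1 => (forall x, U x -> differentiable f x) /\
             forall v : V, Ck_on k' U (fun x => 'd f x v)
  end.

Definition smooth_on (R : realType) (V W : normedModType R)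
    (U : set V) (f : V -> W) : Prop :=
  forall k, Ck_on k U f.

(* A homeomorphism cmap from the open set cdom onto an open subset of R^n, with
   inverse cinv; the values of cmap and cinv elsewhere are irrelevant. *)
Record chart (R : realType) (n : nat) (M : topologicalType) := Chart {
  cdom : set M;
  cmap : M -> 'rV[R]_n;
  cinv : 'rV[R]_n -> M;
  cdom_open : open cdom;
  cimg_open : open (cmap @` cdom);
  cmap_continuous : forall x, cdom x -> {for x, continuous cmap};
  cinv_continuous : forall y, (cmap @` cdom) y -> {for y, continuous cinv};
  cmapK : forall x, cdom x -> cinv (cmap x) = x
}.

(* The smooth structure is given by a (not necessarily maximal) atlas. The
   function chart_at selects a preferred chart around each point; it serves to
   represent tangent vectors, see below. *)
Record manifold (R : realType) (n : nat) := Manifold {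
  carrier :> topologicalType;
  atlas : set (chart R n carrier);
  chart_at : carrier -> chart R n carrier;
  manifold_hausdorff : hausdorff_space carrier;
  manifold_second_countable : @second_countable carrier;
  manifold_connected : connected [set: carrier];
  chart_at_atlas : forall x, atlas (chart_at x);
  chart_at_dom : forall x, cdom (chart_at x) x;
  atlas_compatible : forall c d, atlas c -> atlas d ->
    smooth_on (cmap c @` (cdom c `&` cdom d)) (cmap d \o cinv c)
}.

(* A tangent vector at x is represented by its coordinates, in 'rV[R]_n, with
   respect to the preferred chart chart_at x. Thus a vector field is a function
   M -> 'rV[R]_n, but its smoothness has to be tested in a fixed chart, after
   the change of coordinates tcoord. *)

Definition tcoord (R : realType) (n : nat) (M : manifold R n)
    (c : chart R n M) (x : M) (v : 'rV[R]_n) : 'rV[R]_n :=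
  'd (cmap c \o cinv (chart_at x)) (cmap (chart_at x) x) v.

Definition vf_in_chart (R : realType) (n : nat) (M : manifold R n)
    (c : chart R n M) (X : M -> 'rV[R]_n) (y : 'rV[R]_n) : 'rV[R]_n :=
  tcoord c (cinv c y) (X (cinv c y)).

Definition smooth_vf_on (R : realType) (n : nat) (M : manifold R n)
    (U : set M) (X : M -> 'rV[R]_n) : Prop :=
  forall c, atlas c ->
    smooth_on (cmap c @` (cdom c `&` U)) (vf_in_chart c X).

Definition smooth_fun_on (R : realType) (n : nat) (M : manifold R n)
    (U : set M) (f : M -> R) : Prop :=
  forall c, atlas c -> smooth_on (cmap c @` (cdom c `&` U)) (f \o cinv c).

Definition vf_deriv (R : realType) (n : nat) (M : manifold R n)
    (X : M -> 'rV[R]_n) (f : M -> R) (x : M) : R :=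
  'd (f \o cinv (chart_at x)) (cmap (chart_at x) x) (X x).

Definition lie_bracket (R : realType) (n : nat) (M : manifold R n)
    (X Y : M -> 'rV[R]_n) (x : M) : 'rV[R]_n :=
  let c := chart_at x in
  'd (vf_in_chart c Y) (cmap c x) (X x) - 'd (vf_in_chart c X) (cmap c x) (Y x).

Definition smooth_map (R : realType) (m n : nat) (M : manifold R m)
    (N : manifold R n) (f : M -> N) : Prop :=
  continuous f /\
  forall c d, atlas c -> atlas d ->
    smooth_on (cmap c @` (cdom c `&` f @^-1` cdom d))
              (cmap d \o f \o cinv c).

Definition tangent_map (R : realType) (m n : nat) (M : manifold R m)
    (N : manifold R n) (f : M -> N) (x : M) : 'Hom('rV[R]_m, 'rV[R]_n) :=
  linfun ('d (cmap (chart_at (f x)) \o f \o cinv (chart_at x))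
             (cmap (chart_at x) x)).

Definition immersion (R : realType) (m n : nat) (M : manifold R m)
    (N : manifold R n) (f : M -> N) : Prop :=
  smooth_map f /\ forall x, lker (tangent_map f x) = 0%VS.

Definition distribution (R : realType) (n : nat) (M : manifold R n) : Type :=
  M -> {vspace 'rV[R]_n}.

(* Smooth of constant rank, i.e. a subbundle of the tangent bundle. *)
Definition regular_distribution (R : realType) (n : nat) (M : manifold R n)
    (D : distribution M) : Prop :=
  exists k : nat, forall x : M, exists (U : set M) (X : 'I_k -> M -> 'rV[R]_n),
    [/\ open U, U x, forall i, smooth_vf_on U (X i) &
        forall y, U y -> basis_of (D y) [seq X i y | i : 'I_k]].

Definition local_section (R : realType) (n : nat) (M : manifold R n)
    (D : distribution M) (U : set M) (X : M -> 'rV[R]_n) : Prop :=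
  smooth_vf_on U X /\ forall x, U x -> X x \in D x.

Definition involutive (R : realType) (n : nat) (M : manifold R n)
    (D : distribution M) : Prop :=
  forall (U : set M) (X Y : M -> 'rV[R]_n), open U ->
    local_section D U X -> local_section D U Y ->
    forall x, U x -> lie_bracket X Y x \in D x.

(* A foliation is given by its tangent distribution; its leaves are the maximal
   integral manifolds of the latter, see leaf. *)
Definition foliation (R : realType) (n : nat) (M : manifold R n)
    (TF : distribution M) : Prop :=
  regular_distribution TF /\ involutive TF.

Definition integral_manifold (R : realType) (n : nat) (M : manifold R n)
    (D : distribution M) (m : nat) (N : manifold R m) (j : N -> M) : Prop :=
  [/\ injective j, immersion j & forall p, limg (tangent_map j p) = D (j p)].

Definition leaf (R : realType) (n : nat) (M : manifold R n)
    (TF : distribution M) (m : nat) (F : manifold R m) (i : F -> M) : Prop :=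
  integral_manifold TF i /\
  forall (m' : nat) (N : manifold R m') (j : N -> M),
    integral_manifold TF j -> range i `<=` range j -> range j = range i.

(* A leafwise two-form is evaluated on vectors tangent to the leaves only; the
   values of om z at other pairs of vectors are irrelevant. *)
Definition leafwise_two_form (R : realType) (n : nat) (M : manifold R n)
    (TF : distribution M) (om : M -> 'rV[R]_n -> 'rV[R]_n -> R) : Prop :=
  [/\ forall z (a : R) u u' v, u \in TF z -> u' \in TF z -> v \in TF z ->
        om z (a *: u + u') v = a * om z u v + om z u' v,
      forall z u v, u \in TF z -> v \in TF z -> om z u v = - om z v u &
      forall (U : set M) (X Y : M -> 'rV[R]_n), open U ->
        local_section TF U X -> local_section TF U Y ->
        smooth_fun_on U (fun z => om z (X z) (Y z))].

Definition leafwise_nondegenerate (R : realType) (n : nat) (M : manifold R n)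
    (TF : distribution M) (om : M -> 'rV[R]_n -> 'rV[R]_n -> R) : Prop :=
  forall z u, u \in TF z -> (forall v, v \in TF z -> om z u v = 0) -> u = 0.

(* Koszul formula for the leafwise exterior differential (d om)(X0, X1, X2),
   meant for local sections X0, X1, X2 of the tangent distribution. *)
Definition leafwise_d (R : realType) (n : nat) (M : manifold R n)
    (om : M -> 'rV[R]_n -> 'rV[R]_n -> R)
    (X0 X1 X2 : M -> 'rV[R]_n) (z : M) : R :=
  vf_deriv X0 (fun y => om y (X1 y) (X2 y)) z
  - vf_deriv X1 (fun y => om y (X0 y) (X2 y)) z
  + vf_deriv X2 (fun y => om y (X0 y) (X1 y)) z
  - om z (lie_bracket X0 X1 z) (X2 z)
  + om z (lie_bracket X0 X2 z) (X1 z)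
  - om z (lie_bracket X1 X2 z) (X0 z).

Definition leafwise_closed (R : realType) (n : nat) (M : manifold R n)
    (TF : distribution M) (om : M -> 'rV[R]_n -> 'rV[R]_n -> R) : Prop :=
  forall (U : set M) (X0 X1 X2 : M -> 'rV[R]_n), open U ->
    local_section TF U X0 -> local_section TF U X1 -> local_section TF U X2 ->
    forall z, U z -> leafwise_d om X0 X1 X2 z = 0.

Definition symplectic_foliation (R : realType) (n : nat) (M : manifold R n)
    (TF : distribution M) (om : M -> 'rV[R]_n -> 'rV[R]_n -> R) : Prop :=
  [/\ foliation TF, leafwise_two_form TF om, leafwise_nondegenerate TF om &
      leafwise_closed TF om].

Definition isotropic (R : realType) (n : nat)
    (b : 'rV[R]_n -> 'rV[R]_n -> R) (W : {vspace 'rV[R]_n}) : Prop :=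
  forall u v, u \in W -> v \in W -> b u v = 0.

(* Maximality is fibrewise: T z is maximal among the isotropic subspaces of
   TF z. Maximality with respect to inclusion among all isotropic regular
   involutive distributions on M would be a different, global condition: the
   zero distribution on the sphere S^2 has it, as S^2 admits no line field. *)
Definition polarization (R : realType) (n : nat) (M : manifold R n)
    (TF : distribution M) (om : M -> 'rV[R]_n -> 'rV[R]_n -> R)
    (T : distribution M) : Prop :=
  [/\ regular_distribution T, involutive T,
      forall z, (T z <= TF z)%VS,
      forall z, isotropic (om z) (T z) &
      forall z (W : {vspace 'rV[R]_n}), (T z <= W)%VS -> (W <= TF z)%VS ->
        isotropic (om z) W -> W = T z].

(* The foliation with the single leaf M. *)
Definition tangent_distribution (R : realType) (n : nat) (M : manifold R n) :
    distribution M :=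
  fun=> fullv.

Definition symplectic_manifold (R : realType) (n : nat) (M : manifold R n)
    (om : M -> 'rV[R]_n -> 'rV[R]_n -> R) : Prop :=
  symplectic_foliation (@tangent_distribution R n M) om.

Definition symplectic_manifold_polarization (R : realType) (n : nat)
    (M : manifold R n) (om : M -> 'rV[R]_n -> 'rV[R]_n -> R)
    (T : distribution M) : Prop :=
  polarization (@tangent_distribution R n M) om T.

Definition pullback_form (R : realType) (m n : nat) (N : manifold R m)
    (M : manifold R n) (f : N -> M) (om : M -> 'rV[R]_n -> 'rV[R]_n -> R) :
    N -> 'rV[R]_m -> 'rV[R]_m -> R :=
  fun p u v => om (f p) (tangent_map f p u) (tangent_map f p v).

Definition pullback_distribution (R : realType) (m n : nat) (N : manifold R m)
    (M : manifold R n) (f : N -> M) (D : distribution M) : distribution N :=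
  fun p => (tangent_map f p @^-1: D (f p))%VS.

(* Main.v *)
From HB Require Import structures.
Require Import Defs.
From mathcomp Require Import all_boot all_order all_algebra.
From mathcomp Require Import all_classical all_reals.
From mathcomp Require Import topology normedtype landau derive.
From mathcomp Require Import ring.

(* A leaf [f : F -> Z] is an injective immersion with
   [limg (tangent_map f p) = TF (f p)], so isotropy, maximality and
   non-degeneracy are fibrewise linear algebra; the difficulty is smoothness,
   involutivity and closedness. Near a point, a regular distribution [D] is the
   image, in a chart, of a smooth field [P] of projectors, and involutivity of
   [D] says that the sections [t *m P], [t] in [D x], have vanishing brackets at
   [x]. If [X], [Y] are tangent to [f^* D], then their images [X'], [Y'] under
   [df], as functions on [F], satisfy [X' *m P (f y) = X'] and
   [df [X, Y] = d_X Y' - d_Y X'], by the symmetry of the second derivatives of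
   [f]; differentiating the first identity shows that [df [X, Y]] is fixed by
   [P], i.e. belongs to [D]. Likewise, the leafwise form is represented by the
   Gram matrix [G] of the sections [t *m P]: its closedness on these commuting
   sections is an identity between the derivatives of [G] alone, to which the
   Koszul formula of the pulled back form reduces. *)

Set Implicit Arguments.
Unset Strict Implicit.
Unset Printing Implicit Defensive.

Import Order.TTheory GRing.Theory Num.Theory.
Import numFieldNormedType.Exports.

Local Open Scope classical_set_scope.
Local Open Scope ring_scope.

(** * Germs of smooth maps *)

Section Germs.
Context {R : realType}.
Implicit Types V W : normedModType R.

(** The first-order expansion at [x] is a condition on germs, so [g] inherits that of [f], and
    [diff_unique] identifies the two differentials. *)
Lemma near_eq_diff V W (f g : V -> W) x :
  (\forall y \near x, f y = g y) -> differentiable f x ->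
  differentiable g x /\ 'd g x = 'd f x :> (V -> W).
Proof.
move=> fg df; have fgx : f x = g x := nbhs_singleton fg.
have fg0 : \forall h \near (0 : V), f (h + x) = g (h + x).
  by move: fg; rewrite (near_shift 0); apply: filterS => h /=; rewrite subr0.
have [dc dE] := (diff_locallyP x f).1 df.
have gE : g \o shift x = cst (g x) + 'd f x +o_ 0 id.
  apply/eqaddoP => e e0.
  have /eqaddoP/(_ _ e0) := dE; apply: filterS2 fg0 => h /= fgh.
  by rewrite /= -fgx !fctE /= fgh.
have dg := diff_unique dc gE.
by split; [apply/diff_locallyP; rewrite dg|].
Qed.

Lemma diff_near_eq V W (f g : V -> W) x v :
  (\forall y \near x, f y = g y) -> differentiable f x ->
  'd f x v = 'd g x v.
Proof. by move=> fg df; have [_ ->] := near_eq_diff fg df. Qed.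

(** The germ version of [Ck_on]: each condition is required on a neighbourhood of [x], so that [f]
    may be replaced by any map equal to it near [x]. [smooth_onP] leads back to open sets. *)
Fixpoint Ck_at V W (k : nat) (x : V) (f : V -> W) : Prop :=
  match k with
  | 0 => \forall y \near x, {for y, continuous f}
  | k'.+1 => (\forall y \near x, differentiable f y) /\
             forall v : V, Ck_at k' x (fun y => 'd f y v)
  end.

Definition smooth_at V W (x : V) (f : V -> W) : Prop := forall k, Ck_at k x f.

Lemma smooth_onP V W (U : set V) (f : V -> W) : open U ->
  smooth_on U f <-> forall x, U x -> smooth_at x f.
Proof.
move=> oU; split=> [sf x Ux k|sf k].
  elim: k f {sf}(sf k) => [|k IH] f /=.
    by move=> cf; apply: filterS (open_nbhs_nbhs (conj oU Ux)) => y; apply: cf.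
  case=> df ddf; split; last by move=> v; apply: IH.
  by apply: filterS (open_nbhs_nbhs (conj oU Ux)) => y; apply: df.
have {}sf x : U x -> Ck_at k x f by move=> /sf /(_ k).
elim: k f sf => [|k IH] f sf /=; first by move=> x /sf /nbhs_singleton.
split; first by move=> x /sf [/nbhs_singleton].
by move=> v; apply: IH => x /sf [_ /(_ v)].
Qed.

(** By [near_join], the equality near [x] is also an equality near each [y] close to [x]; hence the
    derivatives agree near [x] and the induction goes on. *)
Lemma Ck_near_eq V W k (f g : V -> W) x :
  (\forall y \near x, f y = g y) -> Ck_at k x f -> Ck_at k x g.
Proof.
elim: k f g => [|k IH] f g fg /=.
  apply: filterS2 (near_join fg) => y fgy cfy.
  suff: g @ y --> g y by [].
  rewrite -(nbhs_singleton fgy).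
  by apply: cvg_trans cfy; apply: near_eq_cvg.
case=> df ddf; split.
  apply: filterS2 (near_join fg) df => y fgy dfy.
  by have [] := near_eq_diff fgy dfy.
move=> v; apply: IH (ddf v); apply: filterS2 (near_join fg) df => y fgy dfy.
by have [_ ->] := near_eq_diff fgy dfy.
Qed.

Lemma smooth_near_eq V W (f g : V -> W) x :
  (\forall y \near x, f y = g y) -> smooth_at x f -> smooth_at x g.
Proof. by move=> fg sf k; apply: Ck_near_eq fg _. Qed.

Lemma smooth_eq V W (f g : V -> W) x : f =1 g -> smooth_at x f -> smooth_at x g.
Proof. by move=> /funext ->. Qed.

Lemma CkS V W k (f : V -> W) x : Ck_at k.+1 x f -> Ck_at k x f.
Proof.
elim: k f => [|k IH] f [df ddf] /=.
  by apply: filterS df => y /differentiable_continuous.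
by split=> // v; apply: IH.
Qed.

Lemma smooth_diff V W (f : V -> W) x v :
  smooth_at x f -> smooth_at x (fun y => 'd f y v).
Proof. by move=> sf k; have [_ /(_ v)] := sf k.+1. Qed.

Lemma smooth_near_differentiable V W (f : V -> W) x :
  smooth_at x f -> \forall y \near x, differentiable f y.
Proof. by move=> /(_ 1) []. Qed.

Lemma smooth_differentiable V W (f : V -> W) x :
  smooth_at x f -> differentiable f x.
Proof. by move=> /smooth_near_differentiable /nbhs_singleton. Qed.

Lemma smooth_continuous V W (f : V -> W) x :
  smooth_at x f -> {for x, continuous f}.
Proof. by move=> /smooth_differentiable /differentiable_continuous. Qed.

Lemma Ck_cst V W k (a : W) (x : V) : Ck_at k x (fun=> a).
Proof.
elim: k a => [|k IH] a /=; first by near=> y; apply: cst_continuous.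
split; first by near=> y; apply: differentiable_cst.
by move=> v; apply: Ck_near_eq (IH 0); near=> y; rewrite diff_cst.
Unshelve. all: by end_near. Qed.

Lemma smooth_cst V W (a : W) (x : V) : smooth_at x (fun=> a).
Proof. by move=> k; apply: Ck_cst. Qed.

Lemma Ck_add V W k (f g : V -> W) x :
  Ck_at k x f -> Ck_at k x g -> Ck_at k x (fun y => f y + g y).
Proof.
elim: k f g => [|k IH] f g /=.
  by apply: filterS2 => y fc gc; apply: continuousD.
move=> [df ddf] [dg ddg]; split.
  by move: df dg; apply: filterS2 => y; apply: differentiableD.
move=> v; apply: Ck_near_eq (IH _ _ (ddf v) (ddg v)).
apply: filterS2 df dg => y dfy dgy; apply/esym.
exact: (congr1 (@^~ v) (diffD dfy dgy)).
Qed.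

Lemma Ck_sum V W k (I : Type) (r : seq I) (P : pred I) (f : I -> V -> W) x :
  (forall i, P i -> Ck_at k x (f i)) ->
  Ck_at k x (fun y => \sum_(i <- r | P i) f i y).
Proof.
move=> sf; elim: r => [|i r IH].
  have -> : (fun y => \sum_(i <- [::] | P i) f i y) = fun=> 0.
    by apply/funext => y; rewrite big_nil.
  exact: Ck_cst.
have -> : (fun y => \sum_(j <- i :: r | P j) f j y) =
    if P i then (fun y => f i y + \sum_(j <- r | P j) f j y)
    else (fun y => \sum_(j <- r | P j) f j y).
  by apply/funext => y; rewrite big_cons; case: ifP.
by case: ifP => // Pi; apply: Ck_add => //; apply: sf.
Qed.

Lemma smooth_sum V W (I : Type) (r : seq I) (P : pred I) (f : I -> V -> W) x :
  (forall i, P i -> smooth_at x (f i)) ->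
  smooth_at x (fun y => \sum_(i <- r | P i) f i y).
Proof. by move=> sf k; apply: Ck_sum => i Pi; apply: sf. Qed.

Lemma diff_linear_comp V W W' (L : {linear W -> W'}) (f : V -> W) x v :
  continuous L -> differentiable f x -> 'd (L \o f) x v = L ('d f x v).
Proof.
move=> cL df; rewrite diff_comp //=; last exact: linear_differentiable.
by rewrite diff_lin.
Qed.

Lemma smooth_linear_comp V W W' (L : {linear W -> W'}) (f : V -> W) x :
  continuous L -> smooth_at x f -> smooth_at x (L \o f).
Proof.
move=> cL sf k; move: f sf; elim: k => [|k IH] f sf /=.
  near=> y; apply: continuous_comp; last exact: cL.
  apply: differentiable_continuous; near: y.
  exact: smooth_near_differentiable sf.
have df := smooth_near_differentiable sf; split.
  near=> y; apply: differentiable_comp; last exact: linear_differentiable.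
  by near: y.
move=> v; apply: Ck_near_eq (IH _ (smooth_diff v sf)); near=> y.
by rewrite diff_linear_comp //; near: y.
Unshelve. all: by end_near. Qed.

Lemma Ck_mul V k (f g : V -> R) x :
  Ck_at k x f -> Ck_at k x g -> Ck_at k x (fun y => f y * g y).
Proof.
elim: k f g => [|k IH] f g /=.
  by apply: filterS2 => y fc gc; apply: continuousM.
move=> fk gk; have [[df ddf] [dg ddg]] := (fk, gk); split.
  by move: df dg; apply: filterS2 => y; apply: differentiableM.
(* Each term of the Leibniz rule contains one factor undifferentiated; [CkS] lowers its class to
   [k], as the induction hypothesis requires. *)
move=> v; have := Ck_add (IH _ _ (CkS fk) (ddg v)) (IH _ _ (CkS gk) (ddf v)).
apply: Ck_near_eq.
apply: filterS2 df dg => y dfy dgy; apply/esym.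
exact: (congr1 (@^~ v) (diffM dfy dgy)).
Qed.

Lemma smooth_mul V (f g : V -> R) x :
  smooth_at x f -> smooth_at x g -> smooth_at x (fun y => f y * g y).
Proof. by move=> sf sg k; apply: Ck_mul. Qed.

Lemma smooth_prod V (I : Type) (r : seq I) (f : I -> V -> R) x :
  (forall i, smooth_at x (f i)) ->
  smooth_at x (fun y => \prod_(i <- r) f i y).
Proof.
move=> sf; elim: r => [|i r IH].
  apply: (smooth_eq (W := R) (f := fun=> 1)) (smooth_cst (1 : R) x) => y.
  by rewrite big_nil.
by apply: smooth_eq (smooth_mul (sf i) IH) => y; rewrite big_cons.
Qed.

(** The derivative of [1/f] is [- (1/f)^2 * 'd f]: if [1/f] is of class [k], so is this product,
    whence class [k + 1]. *)
Lemma smooth_inv V (f : V -> R) x : f x != 0 ->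
  smooth_at x f -> smooth_at x (fun y => (f y)^-1).
Proof.
move=> fx0 sf.
have f0 : \forall y \near x, f y != 0.
  have cf : f @ x --> f x := smooth_continuous sf.
  apply: (cf [set z | z != 0]).
  by apply: (@open_nbhs_nbhs R (f x)); split=> //; apply: open_neq.
have df := smooth_near_differentiable sf.
elim=> [|k IH] /=.
  by move: df f0; apply: filterS2 => y dfy fy0;
    apply/differentiable_continuous/differentiableV.
split; first by apply: filterS2 df f0 => y; apply: differentiableV.
move=> v.
have := Ck_mul (Ck_mul (Ck_cst k (-1 : R) x) (Ck_mul IH IH))
  (smooth_diff v sf k).
apply: Ck_near_eq; apply: filterS2 df f0 => y dfy fy0.
by rewrite diffV //= mulN1r -expr2 -exprVn.
Qed.

End Germs.

(** * Matrix-valued maps: products, inverses, composition *)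

Section MatrixGerms.
Context {R : realType}.
Implicit Types V W : normedModType R.

(** A named coordinate function, to carry the linear structure expected by [diff_linear_comp] and
    [smooth_linear_comp]. *)
Definition mx_entry p q (i : 'I_p) (j : 'I_q) (M : 'M[R]_(p, q)) : R := M i j.

Fact mx_entry_linear p q (i : 'I_p) (j : 'I_q) : linear (mx_entry i j).
Proof. by move=> a u v; rewrite /mx_entry !mxE. Qed.

HB.instance Definition _ p q (i : 'I_p) (j : 'I_q) :=
  GRing.isLinear.Build R 'M[R]_(p, q) R *:%R (mx_entry i j)
    (mx_entry_linear i j).

Lemma diff_entry V p q (f : V -> 'M[R]_(p, q)) x v i j :
  differentiable f x -> 'd (fun y => f y i j : R) x v = 'd f x v i j.
Proof.
move=> df.
exact: (diff_linear_comp (L := mx_entry i j) v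
  (@coord_continuous _ _ _ i j) df).
Qed.

Lemma differentiable_mxP V p q (f : V -> 'M[R]_(p, q)) x :
  differentiable f x <-> forall i j, differentiable (fun y => f y i j : R) x.
Proof.
split=> [df i j|df].
  exact: (differentiable_comp df (differentiable_coord (f x) i j)).
have -> : f = \sum_i \sum_j (fun y => f y i j *: delta_mx i j).
  apply/funext => y; rewrite [LHS]matrix_sum_delta fct_sumE.
  by apply: eq_bigr => i _; rewrite fct_sumE.
by do 2!apply: differentiable_sum => ?; apply: differentiableZl.
Qed.

Lemma Ck_scalel V W k (a : V -> R) (c : W) x :
  Ck_at k x a -> Ck_at k x (fun y => a y *: c).
Proof.
elim: k a => [|k IH] a /=.
  by apply: filterS => y ac; apply: continuousZr_tmp.
move=> [da dda]; split.
  by apply: filterS da => y; apply: differentiableZl.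
move=> v; apply: Ck_near_eq (IH _ (dda v)); apply: filterS da => y day.
by apply/esym; exact: (congr1 (@^~ v) (diffZl c day)).
Qed.

Lemma smooth_mxP V p q (f : V -> 'M[R]_(p, q)) x :
  smooth_at x f <-> forall i j, smooth_at x (fun y => f y i j : R).
Proof.
split=> [sf i j|sf].
  exact: (smooth_linear_comp (L := mx_entry i j)
    (@coord_continuous _ _ _ i j) sf).
apply: (smooth_eq (f := fun y => \sum_i \sum_j f y i j *: delta_mx i j)).
  by move=> y; rewrite -matrix_sum_delta.
by do 2!apply: smooth_sum => ? _; move=> k; apply: Ck_scalel; apply: sf.
Qed.

Lemma differentiable_mulmx V p q r (A : V -> 'M[R]_(p, q))
    (B : V -> 'M[R]_(q, r)) x :
  differentiable A x -> differentiable B x ->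
  differentiable (fun y => A y *m B y) x.
Proof.
move=> /differentiable_mxP dA /differentiable_mxP dB.
apply/differentiable_mxP => i j.
have -> : (fun y => (A y *m B y) i j) =
    \sum_k ((fun y => A y i k : R) * (fun y => B y k j)).
  by apply/funext => y; rewrite mxE fct_sumE.
by apply: differentiable_sum => k; apply: differentiableM.
Qed.

Lemma diff_sum V W n (f : 'I_n -> V -> W) x v :
  (forall i, differentiable (f i) x) ->
  'd (fun y => \sum_i f i y) x v = \sum_i 'd (f i) x v.
Proof.
move=> df.
have -> : (fun y => \sum_i f i y) = \sum_i f i.
  by apply/funext => y; rewrite fct_sumE.
(* [diffD] needs the differentiability of both summands, so it is carried along with the formula. *)
suff [] : differentiable (\sum_i f i) x /\
    'd (\sum_i f i) x v = \sum_i 'd (f i) x v by [].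
elim/big_ind2 : _ => [|g a h b [dg <-] [dh <-]|i _]; last by [].
  split; first exact: differentiable_cst.
  exact: (congr1 (@^~ v) (diff_cst (0 : W) x)).
split; first exact: differentiableD.
exact: (congr1 (@^~ v) (diffD dg dh)).
Qed.

Lemma diff_mul V (f g : V -> R) x v :
  differentiable f x -> differentiable g x ->
  'd (fun y => f y * g y) x v = 'd f x v * g x + f x * 'd g x v.
Proof.
move=> df dg; rewrite addrC [X in _ + X]mulrC.
exact: (congr1 (@^~ v) (diffM df dg)).
Qed.

Lemma diff_mulmx V p q r (A : V -> 'M[R]_(p, q)) (B : V -> 'M[R]_(q, r)) x v :
  differentiable A x -> differentiable B x ->
  'd (fun y => A y *m B y) x v = 'd A x v *m B x + A x *m 'd B x v.
Proof.
move=> dA dB; apply/matrixP => i j.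
rewrite -diff_entry; last exact: differentiable_mulmx.
have -> : (fun y => (A y *m B y) i j) = (fun y => \sum_k (A y i k * B y k j)).
  by apply/funext => y; rewrite mxE.
have dAe := (differentiable_mxP A x).1 dA.
have dBe := (differentiable_mxP B x).1 dB.
rewrite diff_sum; last by move=> k; apply: differentiableM.
rewrite !mxE -big_split; apply: eq_bigr => k _.
by rewrite diff_mul // !diff_entry.
Qed.

Lemma smooth_mulmx V p q r (A : V -> 'M[R]_(p, q)) (B : V -> 'M[R]_(q, r)) x :
  smooth_at x A -> smooth_at x B -> smooth_at x (fun y => A y *m B y).
Proof.
move=> /smooth_mxP sA /smooth_mxP sB; apply/smooth_mxP => i j.
apply: (smooth_eq (W := R) (f := fun y => \sum_k A y i k * B y k j)).
  by move=> y; rewrite mxE.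
by apply: smooth_sum => k _; apply: smooth_mul.
Qed.

Lemma smooth_det V n (A : V -> 'M[R]_n) x :
  smooth_at x A -> smooth_at x (fun y => \det (A y)).
Proof.
move=> /smooth_mxP sA; apply: smooth_sum => s _.
by apply: smooth_mul; [exact: smooth_cst|apply: smooth_prod].
Qed.

Lemma near_unitmx V n (A : V -> 'M[R]_n) x : A x \in unitmx ->
  smooth_at x A -> \forall y \near x, A y \in unitmx.
Proof.
rewrite unitmxE unitfE => d0 /smooth_det sd.
have cd : (fun y => \det (A y)) @ x --> \det (A x) := smooth_continuous sd.
suff : \forall y \near x, \det (A y) != 0.
  by apply: filterS => y; rewrite unitmxE unitfE.
apply: (cd [set z | z != 0]); apply: (@open_nbhs_nbhs R (\det (A x))).
by split=> //; exact: open_neq.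
Qed.

(** By Cramer's formula, with smooth determinant and cofactors. [invmx] follows this formula at
    invertible matrices only, so the two maps are compared near [x], where [A y] stays
    invertible. *)
Lemma smooth_invmx V n (A : V -> 'M[R]_n) x : A x \in unitmx ->
  smooth_at x A -> smooth_at x (fun y => invmx (A y)).
Proof.
move=> uA sA; have sd := smooth_det sA.
apply: (smooth_near_eq (f := fun y => (\det (A y))^-1 *: \adj (A y))).
  by apply: filterS (near_unitmx uA sA) => y uy; rewrite /invmx uy.
apply/smooth_mxP => i j.
apply: (smooth_eq (W := R) (f := fun y => (\det (A y))^-1 * \adj (A y) i j)).
  by move=> y; rewrite [RHS]mxE.
apply: smooth_mul; first by apply: smooth_inv => //; rewrite -unitfE -unitmxE.
apply: (smooth_eq (W := R) (f := fun y => cofactor (A y) j i)).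
  by move=> y; rewrite mxE.
apply: smooth_mul; first exact: smooth_cst.
apply: smooth_det; apply/smooth_mxP => k l.
apply: (smooth_eq (W := R) (f := fun y => A y (lift j k) (lift i l))).
  by move=> y; rewrite !mxE.
by move/smooth_mxP: sA; apply.
Qed.

Lemma linear_row_expand n (L : {linear 'rV[R]_n -> R}) v :
  L v = \sum_j v 0 j * L (delta_mx 0 j).
Proof.
rewrite {1}[v]row_sum_delta linear_sum.
by apply: eq_bigr => j _; rewrite linearZ.
Qed.

(** By the chain rule, the derivative of [g \o f] along [v] is a finite sum of products of a
    coordinate of ['d f y v] and a partial derivative of [g] composed with [f]. The latter is again
    a composition of the same kind, so the induction on [k] is for all [g]. *)
Lemma smooth_comp_scalar V n (f : V -> 'rV[R]_n) (g : 'rV[R]_n -> R) x :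
  smooth_at x f -> smooth_at (f x) g -> smooth_at x (fun y => g (f y)).
Proof.
move=> sf sg k; have cf : f @ x --> f x := smooth_continuous sf.
elim: k g sg => [|k IH] g sg /=.
  have := cf _ (smooth_near_differentiable sg).
  apply: filterS2 (smooth_near_differentiable sf) => y dfy dgy.
  by apply: continuous_comp; apply: differentiable_continuous.
have dg := cf _ (smooth_near_differentiable sg).
have df := smooth_near_differentiable sf.
split; first by apply: filterS2 df dg => y; apply: differentiable_comp.
move=> v.
have : Ck_at k x (fun y => \sum_j 'd f y v 0 j * 'd g (f y) (delta_mx 0 j)).
  apply: Ck_sum => j _; apply: Ck_mul; last exact: IH (smooth_diff _ sg).
  by move/smooth_mxP: (smooth_diff v sf); apply.
apply: Ck_near_eq; apply: filterS2 df dg => y dfy dgy.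
by rewrite (diff_comp dfy dgy) /= -linear_row_expand.
Qed.

Lemma smooth_comp V n p q (f : V -> 'rV[R]_n) (g : 'rV[R]_n -> 'M[R]_(p, q)) x :
  smooth_at x f -> smooth_at (f x) g -> smooth_at x (g \o f).
Proof.
move=> sf /smooth_mxP sg; apply/smooth_mxP => i j.
exact: smooth_comp_scalar sf (sg i j).
Qed.

Lemma smooth_jacobian m n (f : 'rV[R]_m -> 'rV[R]_n) x :
  smooth_at x f -> smooth_at x (jacobian f).
Proof.
move=> sf; apply/smooth_mxP => i j.
have /smooth_mxP/(_ 0 j) := smooth_diff (delta_mx 0 i) sf.
by apply: smooth_eq => y; rewrite /jacobian mxE.
Qed.

Lemma mul_jacobian m n (f : 'rV[R]_m -> 'rV[R]_n) x v :
  v *m jacobian f x = 'd f x v.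
Proof. by rewrite /jacobian mul_rV_lin1. Qed.

End MatrixGerms.

(** * Symmetry of second derivatives *)

Section SymmetricSecondDerivative.
Context {R : realType} {V : normedModType R}.
Implicit Types (f : V -> R) (x u v : V).

Lemma is_derive_line f x u (s : R) : differentiable f (x + s *: u) ->
  is_derive s 1 (fun t : R => f (x + t *: u)) ('d f (x + s *: u) u).
Proof.
move=> df.
have dl : is_diff s (fun t : R => x + t *: u) (0 + *:%R^~ u) by apply: is_diffD.
have dfl : differentiable (f \o (fun t : R => x + t *: u)) s.
  exact: differentiable_comp.
apply: DeriveDef; first exact/derivable1_diffP.
by rewrite deriveE // diff_comp //= diff_val !fctE add0r scale1r.
Qed.

Lemma MVT_derivable (f df : R -> R) (h : R) : 0 < h ->
  (forall s, 0 <= s <= h -> is_derive s 1 f (df s)) ->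
  exists2 s, 0 <= s <= h & f h - f 0 = h * df s.
Proof.
move=> h0 dfE.
have [s s0h sE] : exists2 s, s \in `]0, h[%R & f h - f 0 = df s * (h - 0).
  apply: MVT => // [s|].
    by rewrite in_itv /= => /andP[s0 sh]; apply: dfE; rewrite !ltW.
  apply: derivable_within_continuous => s.
  by rewrite in_itv /= => /dfE [].
exists s; last by rewrite sE subr0 mulrC.
by move: s0h; rewrite in_itv /= => /andP[s0 sh]; rewrite !ltW.
Qed.

(** Two applications of the mean value theorem: in the direction [u] to the increment of [f] by
    [h *: v], then in the direction [v] to ['d f _ u]. *)
Lemma second_difference f x u v (h : R) : 0 < h ->
  (forall s t, 0 <= s <= h -> 0 <= t <= h ->
    differentiable f (x + s *: u + t *: v) /\
    differentiable (fun y => 'd f y u) (x + s *: u + t *: v)) ->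
  exists s t, [/\ 0 <= s <= h, 0 <= t <= h &
    (f (x + h *: u + h *: v) - f (x + h *: u)) - (f (x + h *: v) - f x) =
    h * (h * 'd (fun y => 'd f y u) (x + s *: u + t *: v) v)].
Proof.
move=> h0 df; have h0h : 0 <= h <= h by rewrite lexx ltW.
have z0h : 0 <= (0 : R) <= h by rewrite lexx ltW.
have [|s s0h sE] := @MVT_derivable
    (fun s => f (x + h *: v + s *: u) - f (x + s *: u))
    (fun s => 'd f (x + h *: v + s *: u) u - 'd f (x + s *: u) u) h h0.
  move=> s s0h; apply: is_deriveB; apply: is_derive_line.
    by rewrite addrAC; have [] := df _ _ s0h h0h.
  by have [] := df _ _ s0h z0h; rewrite scale0r addr0.
have [|t t0h tE] := @MVT_derivable (fun t => 'd f (x + s *: u + t *: v) u)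
    (fun t => 'd (fun y => 'd f y u) (x + s *: u + t *: v) v) h h0.
  move=> t t0h; apply: (is_derive_line (f := fun y => 'd f y u)).
  by have [] := df _ _ s0h t0h.
rewrite /= in sE tE.
exists s, t; split=> //.
rewrite -tE scale0r addr0 -(addrAC x (h *: v) (s *: u)) -sE.
by rewrite scale0r !addr0 [x + _ + _]addrAC.
Qed.

(** The second difference of [f] is symmetric in [u] and [v], so the two mixed derivatives take a
    common value at points arbitrarily close to [x]; they are continuous at [x], hence equal
    there. *)
Lemma diff_diffC f x u v : smooth_at x f ->
  'd (fun y => 'd f y u) x v = 'd (fun y => 'd f y v) x u.
Proof.
move=> sf; pose g a b y := 'd (fun z => 'd f z a) y b.
have cg a b : g a b @ x --> g a b x.
  exact: smooth_continuous (smooth_diff b (smooth_diff a sf)).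
apply/eqP; rewrite -subr_eq0 -normr_le0; apply/ler_addgt0Pl => e e0.
rewrite addr0 -[_ - _]/(g u v x - g v u x).
have e20 : 0 < e / 2 by rewrite divr_gt0.
have near_x : \forall y \near x, [/\ differentiable f y,
    differentiable (fun z => 'd f z u) y, differentiable (fun z => 'd f z v) y,
    `|g u v x - g u v y| < e / 2 & `|g v u x - g v u y| < e / 2].
  have duv := smooth_near_differentiable (smooth_diff u sf).
  have dvu := smooth_near_differentiable (smooth_diff v sf).
  have df := smooth_near_differentiable sf.
  have /cvgrPdist_lt /(_ _ e20) cuv := cg u v.
  have /cvgrPdist_lt /(_ _ e20) cvu := cg v u.
  by near=> y; split; near: y.
have /nbhs_ballP [r /= r0 rP] := near_x.
(* With this choice [h * (1 + |u| + |v|) = r / 2], so the whole parallelogram of sides [h *: u] and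
   [h *: v] lies in the ball; the summand 1 keeps the denominator positive when [u = v = 0]. *)
pose h := r / (2 * (1 + `|u| + `|v|)).
have k0 : 0 < 1 + `|u| + `|v| by rewrite -addrA ltr_pwDl // addr_ge0.
have h0 : 0 < h by rewrite divr_gt0 // mulr_gt0.
have in_ball s t : 0 <= s <= h -> 0 <= t <= h -> ball x r (x + s *: u + t *: v).
  move=> /andP[s0 sh] /andP[t0 th].
  rewrite -ball_normE /= -addrA opprD addNKr normrN.
  apply: le_lt_trans (ler_normD _ _) _; rewrite !normrZ !ger0_norm //.
  apply: (@le_lt_trans _ _ (h * (1 + `|u| + `|v|))).
    rewrite -addrA !mulrDr mulr1 -[X in X <= _]add0r.
    by rewrite !lerD ?ler_wpM2r // ltW.
  by rewrite /h invfM mulrA mulfVK ?gt_eqF // gtr_pMr ?invf_lt1 ?ltr1n.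
have [s [t [s0 t0 stE]]] : exists s t, [/\ 0 <= s <= h, 0 <= t <= h &
    (f (x + h *: u + h *: v) - f (x + h *: u)) - (f (x + h *: v) - f x) =
    h * (h * g u v (x + s *: u + t *: v))].
  apply: second_difference => // s t s0 t0.
  by have [] := rP _ (in_ball _ _ s0 t0).
have [t' [s' [t'0 s'0 st'E]]] : exists t s, [/\ 0 <= t <= h, 0 <= s <= h &
    (f (x + h *: v + h *: u) - f (x + h *: v)) - (f (x + h *: u) - f x) =
    h * (h * g v u (x + t *: v + s *: u))].
  apply: second_difference => // t' s' t0' s0'; rewrite addrAC.
  by have [] := rP _ (in_ball _ _ s0' t0').
have gE : g u v (x + s *: u + t *: v) = g v u (x + s' *: u + t' *: v).
  have hn0 : h != 0 by rewrite gt_eqF.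
  apply/(mulfI hn0)/(mulfI hn0); rewrite -stE [x + s' *: u + _]addrAC -st'E.
  by rewrite [x + h *: v + _]addrAC; ring.
have [_ _ _ guv _] := rP _ (in_ball _ _ s0 t0).
have [_ _ _ _ gvu] := rP _ (in_ball _ _ s'0 t'0).
rewrite -(subrKA (g u v (x + s *: u + t *: v))) {2}gE.
apply: le_trans (ler_normD _ _) _; rewrite [leRHS]splitr.
by rewrite lerD // ltW // distrC.
Unshelve. all: by end_near. Qed.

End SymmetricSecondDerivative.

Lemma diff_diffC_mx (R : realType) (V : normedModType R) (p q : nat)
    (f : V -> 'M[R]_(p, q)) (x u v : V) : smooth_at x f ->
  'd (fun y => 'd f y u) x v = 'd (fun y => 'd f y v) x u.
Proof.
move=> sf; apply/matrixP => i j.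
have dE a b : 'd (fun y => 'd f y a) x b i j =
    'd (fun y => 'd (fun z => f z i j : R) y a) x b.
  have sfa := smooth_diff a sf.
  rewrite -diff_entry; last exact: smooth_differentiable.
  apply/esym; apply: diff_near_eq.
    apply: filterS (smooth_near_differentiable sf) => y dfy.
    by rewrite diff_entry.
  by apply/smooth_differentiable/smooth_diff; move/smooth_mxP: sf; apply.
by rewrite !dE diff_diffC //; move/smooth_mxP: sf; apply.
Qed.

(** * Charts and vector fields *)

Section Charts.
Context {R : realType}.

(** Carries neighbourhoods from the manifold to the chart, by openness of the chart image and
    continuity of [cinv]. It also confines the argument to the points where [cinv] is a genuine
    inverse. *)
Lemma near_cinv n (M : topologicalType) (c : chart R n M) x (P : set M) :
  cdom c x -> (\forall z \near x, P z) ->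
  \forall y \near cmap c x,
    [/\ cdom c (cinv c y), cmap c (cinv c y) = y & P (cinv c y)].
Proof.
move=> cx Px; have icx : (cmap c @` cdom c) (cmap c x) by exists x.
have cimg : \forall y \near cmap c x, (cmap c @` cdom c) y.
  by apply: open_nbhs_nbhs; split=> //; exact: cimg_open.
have ci : cinv c @ cmap c x --> x.
  by rewrite -[X in _ --> X](cmapK cx); exact: cinv_continuous.
by apply: filterS2 cimg (ci _ Px) => _ [z cz <-]; rewrite /= cmapK.
Qed.

Lemma open_cmap_image n (M : topologicalType) (c : chart R n M) (U : set M) :
  open U -> open (cmap c @` (cdom c `&` U)).
Proof.
move=> oU; rewrite openE => _ [x [cx Ux] <-].
have := near_cinv cx (open_nbhs_nbhs (conj oU Ux)).
by apply: filterS => y [cy yE Uy]; exists (cinv c y).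
Qed.

(** The chain rule, where the intermediate chart [d] cancels only near [cmap c x], as long as [f]
    has values in [cdom d]. With [f] or [g] the identity it covers changes of coordinates. *)
Lemma diff_chart_comp m n p (M N Q : topologicalType) (c : chart R m M)
    (d : chart R n N) (e : chart R p Q) (f : M -> N) (g : N -> Q) (x : M) v :
  {for x, continuous f} -> cdom c x -> cdom d (f x) ->
  differentiable (cmap d \o f \o cinv c) (cmap c x) ->
  differentiable (cmap e \o g \o cinv d) (cmap d (f x)) ->
  'd (cmap e \o g \o cinv d) (cmap d (f x))
    ('d (cmap d \o f \o cinv c) (cmap c x) v) =
  'd (cmap e \o (g \o f) \o cinv c) (cmap c x) v.
Proof.
move=> cf cx dfx df dg.
have fE : (cmap d \o f \o cinv c) (cmap c x) = cmap d (f x).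
  by rewrite /= cmapK.
have dg' : differentiable (cmap e \o g \o cinv d)
    ((cmap d \o f \o cinv c) (cmap c x)) by rewrite fE.
have <- := congr1 (fun y => 'd (cmap e \o g \o cinv d) y
  ('d (cmap d \o f \o cinv c) (cmap c x) v)) fE.
apply: etrans (esym (congr1 (@^~ v) (diff_comp df dg'))) _.
apply: diff_near_eq; last exact: differentiable_comp.
have df_near : \forall z \near x, cdom d (f z).
  by apply: cf; apply: open_nbhs_nbhs; split=> //; exact: cdom_open.
apply: filterS (near_cinv cx df_near) => y [cy yE dy].
by rewrite /= cmapK.
Qed.

End Charts.

(** * Vector fields and smooth maps of manifolds, read in charts *)

Section Manifolds.
Context {R : realType}.

Lemma smooth_transition n (M : manifold R n) (c d : chart R n M) x :
  atlas c -> atlas d -> cdom c x -> cdom d x ->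
  smooth_at (cmap c x) (cmap d \o cinv c).
Proof.
move=> ac ad cx dx.
have /smooth_onP sU := atlas_compatible ac ad.
by apply: sU; [exact: open_cmap_image (cdom_open d)|exists x].
Qed.

Lemma differentiable_transition n (M : manifold R n) (c d : chart R n M) x :
  atlas c -> atlas d -> cdom c x -> cdom d x ->
  differentiable (cmap d \o cinv c) (cmap c x).
Proof. by move=> *; apply/smooth_differentiable/smooth_transition. Qed.

Lemma diff_transition_comp n (M : manifold R n) (c d e : chart R n M) x v :
  atlas c -> atlas d -> atlas e -> cdom c x -> cdom d x -> cdom e x ->
  'd (cmap e \o cinv d) (cmap d x) ('d (cmap d \o cinv c) (cmap c x) v) =
  'd (cmap e \o cinv c) (cmap c x) v.
Proof.
move=> ac ad ae cx dx ex.
apply: (diff_chart_comp (f := id) (g := id)) => //.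
- exact: differentiable_transition.
- exact: differentiable_transition.
Qed.

Lemma diff_transition_id n (M : manifold R n) (c : chart R n M) x v :
  cdom c x -> 'd (cmap c \o cinv c) (cmap c x) v = v.
Proof.
move=> cx.
have idE : 'd id (cmap c x) = id :> ('rV[R]_n -> 'rV[R]_n) by apply: diff_val.
apply: etrans (congr1 (@^~ v) idE); apply/esym; apply: diff_near_eq => //.
by apply: filterS (near_cinv cx filterT) => y [_ /= -> _].
Qed.

Definition untcoord n (M : manifold R n) (c : chart R n M) (x : M)
    (v : 'rV[R]_n) : 'rV[R]_n :=
  'd (cmap (chart_at x) \o cinv c) (cmap c x) v.

Lemma tcoordK n (M : manifold R n) (c : chart R n M) x :
  atlas c -> cdom c x -> cancel (tcoord c x) (untcoord c x).
Proof.
move=> ac cx v; rewrite /untcoord /tcoord.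
rewrite diff_transition_comp ?diff_transition_id //;
  by [exact: chart_at_atlas|exact: chart_at_dom].
Qed.

Lemma untcoordK n (M : manifold R n) (c : chart R n M) x :
  atlas c -> cdom c x -> cancel (untcoord c x) (tcoord c x).
Proof.
move=> ac cx v; rewrite /untcoord /tcoord.
rewrite diff_transition_comp ?diff_transition_id //;
  by [exact: chart_at_atlas|exact: chart_at_dom].
Qed.

Lemma tcoord_chart_at n (M : manifold R n) (x : M) v :
  tcoord (chart_at x) x v = v.
Proof. exact: diff_transition_id (chart_at_dom x). Qed.

Lemma untcoord_chart_at n (M : manifold R n) (x : M) v :
  untcoord (chart_at x) x v = v.
Proof. exact: diff_transition_id (chart_at_dom x). Qed.

HB.instance Definition _ n (M : manifold R n) (c : chart R n M) x :=
  GRing.Linear.copy (tcoord c x)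
    ('d (cmap c \o cinv (chart_at x)) (cmap (chart_at x) x)).

HB.instance Definition _ n (M : manifold R n) (c : chart R n M) x :=
  GRing.Linear.copy (untcoord c x)
    ('d (cmap (chart_at x) \o cinv c) (cmap c x)).

Lemma tcoord_change n (M : manifold R n) (c d : chart R n M) x v :
  atlas c -> atlas d -> cdom c x -> cdom d x ->
  tcoord d x v = 'd (cmap d \o cinv c) (cmap c x) (tcoord c x v).
Proof.
move=> ac ad cx dx; apply/esym; apply: diff_transition_comp => //;
  by [exact: chart_at_atlas|exact: chart_at_dom].
Qed.

Lemma vf_in_chartE n (M : manifold R n) (c : chart R n M) X (x : M) :
  cdom c x -> vf_in_chart c X (cmap c x) = tcoord c x (X x).
Proof. by move=> cx; rewrite /vf_in_chart cmapK. Qed.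

(** Near [cmap d x], the field in [d] is the field in [c] composed with the transition from [d] to
    [c], times the Jacobian of the transition from [c] to [d]. *)
Lemma smooth_vf_chart_change n (M : manifold R n) (c d : chart R n M) X x :
  atlas c -> atlas d -> cdom c x -> cdom d x ->
  smooth_at (cmap c x) (vf_in_chart c X) ->
  smooth_at (cmap d x) (vf_in_chart d X).
Proof.
move=> ac ad cx dx sX; have st := smooth_transition ad ac dx cx.
have tE : (cmap c \o cinv d) (cmap d x) = cmap c x by rewrite /= cmapK.
apply: (smooth_near_eq (f := fun y =>
    (vf_in_chart c X \o (cmap c \o cinv d)) y *m
    (jacobian (cmap d \o cinv c) \o (cmap c \o cinv d)) y)).
  have cx' : \forall z \near x, cdom c z.
    by apply: open_nbhs_nbhs; split=> //; exact: cdom_open.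
  apply: filterS (near_cinv dx cx') => y [dy yE cy].
  rewrite mul_jacobian /= vf_in_chartE // /vf_in_chart.
  by rewrite -tcoord_change.
apply: smooth_mulmx; apply: smooth_comp; rewrite ?tE //.
exact/smooth_jacobian/smooth_transition.
Qed.

(** Reduces a condition on all charts of the atlas to one conveniently chosen chart at each
    point. *)
Lemma smooth_vf_onP n (M : manifold R n) (U : set M) X : open U ->
  smooth_vf_on U X <-> forall x, U x ->
    exists c, [/\ atlas c, cdom c x & smooth_at (cmap c x) (vf_in_chart c X)].
Proof.
move=> oU; split=> [sX x Ux|sX c ac].
  exists (chart_at x); split; [exact: chart_at_atlas|exact: chart_at_dom|].
  have /smooth_onP sXU := sX _ (chart_at_atlas x).
  apply: sXU; first exact: open_cmap_image.
  by exists x => //; split=> //; exact: chart_at_dom.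
apply/smooth_onP; first exact: open_cmap_image.
move=> _ [x [cx Ux] <-]; have [d [ad dx sXd]] := sX x Ux.
exact: smooth_vf_chart_change sXd.
Qed.

Lemma smooth_vf_on_at n (M : manifold R n) (U : set M) X c x : open U ->
  smooth_vf_on U X -> U x -> atlas c -> cdom c x ->
  smooth_at (cmap c x) (vf_in_chart c X).
Proof.
move=> oU /(smooth_vf_onP _ oU) sX Ux ac cx.
by have [d [ad dx]] := sX x Ux; apply: smooth_vf_chart_change.
Qed.

Lemma smooth_fun_onP n (M : manifold R n) (U : set M) (f : M -> R) : open U ->
  smooth_fun_on U f <-> forall x, U x ->
    smooth_at (cmap (chart_at x) x) (f \o cinv (chart_at x)).
Proof.
move=> oU; split=> [sf x Ux|sf c ac].
  have /smooth_onP sfU := sf _ (chart_at_atlas x).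
  by apply: sfU; [exact: open_cmap_image|exists x => //; split=> //;
    exact: chart_at_dom].
apply/smooth_onP; first exact: open_cmap_image.
move=> _ [x [cx Ux] <-]; have dx := chart_at_dom x.
have st := smooth_transition ac (chart_at_atlas x) cx dx.
have tE : (cmap (chart_at x) \o cinv c) (cmap c x) = cmap (chart_at x) x.
  by rewrite /= cmapK.
apply: (smooth_near_eq
    (f := fun y => (f \o cinv (chart_at x)) ((cmap (chart_at x) \o cinv c) y))).
  have dx_near : \forall z \near x, cdom (chart_at x) z.
    by apply: open_nbhs_nbhs; split=> //; exact: cdom_open.
  apply: filterS (near_cinv cx dx_near) => y [_ _ dy].
  by rewrite /= cmapK.
by apply: smooth_comp_scalar; rewrite ?tE //; apply: sf.
Qed.

Definition lift_vf n (M : manifold R n) (c : chart R n M)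
    (s : 'rV[R]_n -> 'rV[R]_n) (x : M) : 'rV[R]_n :=
  untcoord c x (s (cmap c x)).

Lemma near_vf_in_chart_lift n (M : manifold R n) (c : chart R n M) s (x : M) :
  atlas c -> cdom c x ->
  \forall y \near cmap c x, s y = vf_in_chart c (lift_vf c s) y.
Proof.
move=> ac cx; apply: filterS (near_cinv cx filterT) => y [cy yE _].
by rewrite /vf_in_chart /lift_vf untcoordK // yE.
Qed.

Lemma smooth_lift_vf n (M : manifold R n) (c : chart R n M) s (U : set M) :
  open U -> atlas c -> U `<=` cdom c ->
  (forall x, U x -> smooth_at (cmap c x) s) -> smooth_vf_on U (lift_vf c s).
Proof.
move=> oU ac Uc ss; apply/smooth_vf_onP => // x Ux.
exists c; split=> //; first exact: Uc.
apply: smooth_near_eq (ss x Ux); apply: near_vf_in_chart_lift => //.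
exact: Uc.
Qed.

Lemma smooth_map_chart m n (M : manifold R m) (N : manifold R n) (f : M -> N)
    c d x :
  smooth_map f -> atlas c -> atlas d -> cdom c x -> cdom d (f x) ->
  smooth_at (cmap c x) (cmap d \o f \o cinv c).
Proof.
move=> [cf sf] ac ad cx dfx.
have oU : open (f @^-1` cdom d).
  by apply: open_comp; [move=> ? _; exact: cf|exact: cdom_open].
have /smooth_onP sU := sf c d ac ad.
by apply: sU; [exact: open_cmap_image|exists x].
Qed.

(** Frees [tangent_map] from the preferred charts: both sides are the differential of
    [cmap d \o f \o cinv (chart_at x)] at the centre, applied to [v]. *)
Lemma tcoord_tangent_map m n (M : manifold R m) (N : manifold R n) (f : M -> N)
    c d x v :
  smooth_map f -> atlas c -> atlas d -> cdom c x -> cdom d (f x) ->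
  tcoord d (f x) (tangent_map f x v) =
    'd (cmap d \o f \o cinv c) (cmap c x) (tcoord c x v).
Proof.
move=> sf ac ad cx dfx; have cfx : {for x, continuous f}.
  by have [cf _] := sf; exact: cf.
have ax := chart_at_atlas x; have afx := chart_at_atlas (f x).
have dx := chart_at_dom x; have dfx' := chart_at_dom (f x).
rewrite /tangent_map lfunE /= /tcoord.
rewrite (diff_chart_comp (f := f) (g := id)) //.
- apply/esym; apply: (diff_chart_comp (f := id) (g := f)) => //.
    exact: differentiable_transition.
  exact: smooth_differentiable (smooth_map_chart _ _ _ _ _).
- exact: smooth_differentiable (smooth_map_chart _ _ _ _ _).
- exact: differentiable_transition.
Qed.

End Manifolds.

(** * Regular distributions as images of projectors *)

Section Projectors.
Context {R : realType}.

Lemma basis_of_family (vT : vectType R) (W : {vspace vT}) k (X : 'I_k -> vT) :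
  basis_of W [seq X i | i : 'I_k] ->
  [/\ forall i, X i \in W,
      forall u, u \in W -> exists a : 'rV[R]_k, u = \sum_i a 0 i *: X i &
      forall a : 'rV[R]_k, \sum_i a 0 i *: X i = 0 -> a = 0].
Proof.
pose t := [tuple X i | i < k].
have -> : [seq X i | i : 'I_k] = t by rewrite /t /= /image_mem.
have tE (i : 'I_k) : t`_i = X i by rewrite -tnth_nth tnth_mktuple.
move=> /andP[/eqP <- /freeP ft]; split.
- by move=> i; rewrite -(tnth_mktuple X i) memv_span // mem_tnth.
- move=> u /coord_span ->; exists (\row_i coord t i u).
  by apply: eq_bigr => i _; rewrite mxE tE.
- move=> a a0; apply/rowP => i; rewrite mxE (ft (fun i => a 0 i)) //.
  by rewrite -[RHS]a0; apply: eq_bigr => j _; rewrite tE.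
Qed.

Lemma left_invertible_rows k n (A : 'M[R]_(k, n)) :
  (forall v : 'rV_k, v *m A = 0 -> v = 0) -> exists B, A *m B = 1%:M.
Proof. by move=> A_inj; apply/row_freeP/inj_row_free. Qed.

(** In the coordinates of [c], right multiplication by [P] maps into [D] and fixes [D]: it is an
    idempotent with image [D], whose kernel may be arbitrary. *)
Definition chart_projector n (M : manifold R n) (D : distribution M)
    (c : chart R n M) (V : set M) (P : 'rV[R]_n -> 'M[R]_n) : Prop :=
  forall z, V z ->
  [/\ smooth_at (cmap c z) P,
      forall v, untcoord c z (v *m P (cmap c z)) \in D z &
      forall u, u \in D z -> tcoord c z u *m P (cmap c z) = tcoord c z u].

(** The rows of [S] form a local frame of [D] in the chart. If [B] is a right inverse of [S] at [x],
    then [S *m B] remains invertible near [x], and [P = B (S B)^-1 S] has its rows in the row space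
    of [S] and satisfies [S P = S]. *)
Lemma regular_projector n (M : manifold R n) (D : distribution M) c x :
  regular_distribution D -> atlas c -> cdom c x ->
  exists V P, [/\ open V, V x, V `<=` cdom c & chart_projector D c V P].
Proof.
move=> [k /(_ x) [U [X [oU Ux sX bX]]]] ac cx.
pose S y := \matrix_(i < k) vf_in_chart c (X i) y.
have SE z : cdom c z -> forall a, a *m S (cmap c z) =
    tcoord c z (\sum_i a 0 i *: X i z).
  move=> cz a; rewrite mulmx_sum_row linear_sum; apply: eq_bigr => i _.
  by rewrite rowK vf_in_chartE // linearZ.
have sS z : U z -> cdom c z -> smooth_at (cmap c z) S.
  move=> Uz cz; apply/smooth_mxP => i j.
  have /smooth_mxP/(_ 0 j) := smooth_vf_on_at oU (sX i) Uz ac cz.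
  by apply: smooth_eq => y; rewrite mxE.
have [B SB] : exists B, S (cmap c x) *m B = 1%:M.
  apply: left_invertible_rows => a; rewrite SE // => /(congr1 (untcoord c x)).
  by rewrite tcoordK // linear0; have [_ _] := basis_of_family (bX x Ux); apply.
pose V := [set z | [/\ U z, cdom c z & S (cmap c z) *m B \in unitmx]].
pose P y := B *m invmx (S y *m B) *m S y.
have sSB z : U z -> cdom c z -> smooth_at (cmap c z) (fun y => S y *m B).
  by move=> Uz cz; apply: smooth_mulmx (sS z Uz cz) (smooth_cst B _).
exists V, P; split.
- rewrite openE => z [Uz cz uz].
  have Un : \forall y \near z, U y by exact: open_nbhs_nbhs.
  have cn : \forall y \near z, cdom c y.
    by apply: open_nbhs_nbhs; split=> //; exact: cdom_open.
  have un : \forall y \near z, S (cmap c y) *m B \in unitmx.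
    have un := near_unitmx (A := fun y => S y *m B) uz (sSB z Uz cz).
    exact: (cmap_continuous cz un).
  by move: un; apply: filterS3 Un cn => y.
- by split; rewrite // SB unitmx1.
- by move=> z [].
move=> z [Uz cz uz]; have [XD XS X0] := basis_of_family (bX z Uz); split.
- have sSBz := sSB z Uz cz.
  apply: smooth_mulmx (sS z Uz cz).
  apply: smooth_mulmx; first exact: smooth_cst.
  exact: (smooth_invmx (A := fun y => S y *m B)).
- move=> v; rewrite mulmxA SE // tcoordK //.
  by apply: memv_suml => i _; rewrite memvZ.
- by move=> _ /XS[a ->]; rewrite -SE // !mulmxA -(mulmxA a) mulmxK.
Qed.

(** A constant vector of the chart, projected to the distribution: in the chart, all its derivatives
    come from [P]. *)
Definition projected_section n (M : manifold R n) (c : chart R n M)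
    (P : 'rV[R]_n -> 'M[R]_n) (u : 'rV[R]_n) : M -> 'rV[R]_n :=
  lift_vf c (fun y => u *m P y).

Lemma local_projected_section n (M : manifold R n) (D : distribution M)
    c V P u :
  atlas c -> open V -> V `<=` cdom c -> chart_projector D c V P ->
  local_section D V (projected_section c P u).
Proof.
move=> ac oV Vc PD; split; last by move=> z Vz; have [_ ->] := PD z Vz.
apply: smooth_lift_vf => // z Vz; have [sPz _ _] := PD z Vz.
by apply: smooth_mulmx => //; apply: smooth_cst.
Qed.

(** * Projected sections at the centre of a preferred chart *)

Section AtCenter.
Context {n : nat} {M : manifold R n} {D : distribution M} {V : set M}.
Context {P : 'rV[R]_n -> 'M[R]_n} {x : M}.
Local Notation c := (chart_at x).
Local Notation y0 := (cmap c x).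
Hypotheses (iD : Defs.involutive D) (oV : open V) (Vx : V x).
Hypotheses (Vc : V `<=` cdom c) (PD : chart_projector D c V P).
Let ac : atlas c := chart_at_atlas x.
Let cx : cdom c x := chart_at_dom x.

Lemma smooth_projector : smooth_at y0 P.
Proof using PD Vx. by have [] := PD Vx. Qed.

Lemma projector_id u : u \in D x -> u *m P y0 = u.
Proof using PD Vx.
by have [_ _ PDx] := PD Vx; move=> /PDx; rewrite tcoord_chart_at.
Qed.

Lemma mem_projector u : u *m P y0 \in D x.
Proof using PD Vx.
by have [_ PDx _] := PD Vx; have := PDx u; rewrite untcoord_chart_at.
Qed.

Lemma projected_section_center u : u \in D x -> projected_section c P u x = u.
Proof using PD Vx.
move=> uD; rewrite /projected_section /lift_vf untcoord_chart_at.
exact: projector_id.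
Qed.

(* Differentiate [P *m P = P]. *)
Lemma projector_diff w u : u \in D x -> u *m 'd P y0 w *m P y0 = 0.
Proof using PD Vx oV.
move=> uD; have dPx := smooth_differentiable smooth_projector.
have PPE : 'd P y0 w = 'd P y0 w *m P y0 + P y0 *m 'd P y0 w.
  apply: etrans (diff_mulmx w dPx dPx); apply: diff_near_eq => //.
  have VP := near_cinv cx (open_nbhs_nbhs (conj oV Vx)).
  apply: filterS VP => y [cy yE Vy]; have [_ Pv PDy] := PD Vy.
  apply/row_matrixP => i; rewrite row_mul -{2 3}yE.
  have := PDy _ (Pv (delta_mx 0 i)).
  by rewrite untcoordK // -rowE yE => ->.
have := congr1 (mulmx u) PPE; rewrite mulmxDr !mulmxA (projector_id uD).
by rewrite -[X in X = _]add0r => /addIr/esym.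
Qed.

Lemma lie_bracket_projected_section s t : s \in D x -> t \in D x ->
  lie_bracket (projected_section c P s) (projected_section c P t) x =
  t *m 'd P y0 s - s *m 'd P y0 t.
Proof using PD Vx.
move=> sD tD; have dPx := smooth_differentiable smooth_projector.
have dXE u w : 'd (vf_in_chart c (projected_section c P u)) y0 w =
    u *m 'd P y0 w.
  have duP : differentiable (fun y => u *m P y) y0.
    by apply: differentiable_mulmx => //; apply: differentiable_cst.
  have lE := near_vf_in_chart_lift (fun y => u *m P y) ac cx.
  apply: etrans (esym (diff_near_eq w lE duP)) _.
  apply: etrans (diff_mulmx w (differentiable_cst u y0) dPx) _.
  have -> : 'd (cst u) y0 w = 0 := congr1 (@^~ w) (diff_cst u y0).
  by rewrite mul0mx add0r.
rewrite /lie_bracket !projected_section_center //.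
by congr (_ - _); exact: dXE.
Qed.

(* The bracket is fixed by [P], as the distribution is involutive, and killed by
   [P], by [projector_diff]. *)
Lemma lie_bracket_projected_section0 s t : s \in D x -> t \in D x ->
  lie_bracket (projected_section c P s) (projected_section c P t) x = 0.
Proof using PD Vc Vx ac iD oV.
move=> sD tD; have lP u := local_projected_section u ac oV Vc PD.
have := iD oV (lP s) (lP t) Vx; rewrite lie_bracket_projected_section //.
by move=> /projector_id <-; rewrite mulmxBl !projector_diff // subr0.
Qed.

(** Involutivity as a pointwise identity on the first derivative of [P], which can be pulled back
    without extending vector fields from the source to the target. *)
Lemma involutive_projector s t : s \in D x -> t \in D x ->
  t *m 'd P y0 s = s *m 'd P y0 t.
Proof using PD Vc Vx ac iD oV.
move=> sD tD; apply/eqP; rewrite -subr_eq0 -lie_bracket_projected_section //.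
by rewrite lie_bracket_projected_section0.
Qed.

End AtCenter.

End Projectors.

(** * Pullback of distributions *)

Section Pullback.
Context {R : realType} {m n : nat} {M : manifold R m} {N : manifold R n}.
Implicit Types (f : M -> N).

Definition chart_rep f (x : M) : 'rV[R]_m -> 'rV[R]_n :=
  cmap (chart_at (f x)) \o f \o cinv (chart_at x).

Lemma smooth_chart_rep f x :
  smooth_map f -> smooth_at (cmap (chart_at x) x) (chart_rep f x).
Proof.
by move=> sf; apply: smooth_map_chart => //;
  by [exact: chart_at_atlas|exact: chart_at_dom].
Qed.

Lemma chart_rep_center f x :
  chart_rep f x (cmap (chart_at x) x) = cmap (chart_at (f x)) (f x).
Proof. by rewrite /chart_rep /= cmapK //; exact: chart_at_dom. Qed.

Lemma tangent_mapE f x v :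
  tangent_map f x v = 'd (chart_rep f x) (cmap (chart_at x) x) v.
Proof. by rewrite /tangent_map lfunE. Qed.

(** The image of [X] under the differential of [f], as a vector field along [f]: a function on the
    chart of the source, with values in the coordinates at [f x]. *)
Definition pushed_vf f x (X : M -> 'rV[R]_m) (y : 'rV[R]_m) : 'rV[R]_n :=
  vf_in_chart (chart_at x) X y *m jacobian (chart_rep f x) y.

Lemma near_chart_rep f x (P : set N) : smooth_map f ->
  (\forall z \near f x, P z) -> \forall y \near cmap (chart_at x) x,
  let z := cinv (chart_at x) y in
  [/\ cdom (chart_at x) z, cmap (chart_at x) z = y,
      cdom (chart_at (f x)) (f z), P (f z) &
      forall X, tcoord (chart_at (f x)) (f z) (tangent_map f z (X z)) =
        pushed_vf f x X y].
Proof.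
move=> sf Pfx; have [cf _] := sf.
have dN : \forall z \near f x, cdom (chart_at (f x)) z.
  by apply: open_nbhs_nbhs; split; [exact: cdom_open|exact: chart_at_dom].
have near_x : \forall z \near x, cdom (chart_at (f x)) (f z) /\ P (f z).
  exact: (cf x _ (filterI dN Pfx)).
apply: filterS (near_cinv (chart_at_dom x) near_x) => y [cy yE [dy Py]].
split=> // X; rewrite /pushed_vf mul_jacobian.
have aM := chart_at_atlas x; have aN := chart_at_atlas (f x).
apply: etrans (tcoord_tangent_map _ sf aM aN cy dy) _.
exact: (congr1 (fun z => 'd (chart_rep f x) z (vf_in_chart _ X y)) yE).
Qed.

Lemma pushed_vf_center f x X :
  pushed_vf f x X (cmap (chart_at x) x) = tangent_map f x (X x).
Proof.
rewrite /pushed_vf vf_in_chartE; last exact: chart_at_dom.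
by rewrite mul_jacobian tcoord_chart_at tangent_mapE.
Qed.

Lemma smooth_pushed_vf f x U X : smooth_map f -> open U -> U x ->
  smooth_vf_on U X -> smooth_at (cmap (chart_at x) x) (pushed_vf f x X).
Proof.
move=> sf oU Ux sX; apply: smooth_mulmx.
  by apply: smooth_vf_on_at oU sX Ux _ _;
    [exact: chart_at_atlas|exact: chart_at_dom].
exact/smooth_jacobian/smooth_chart_rep.
Qed.

(** In charts [X \o f] is [Y *m J]. As [J] is injective at the centre, it has a right inverse [C]
    there, [J *m C] stays invertible nearby, and [Y] is recovered as [(X \o f) C (J C)^-1]. *)
Lemma smooth_vf_pullback f U X Y :
  smooth_map f -> (forall x, lker (tangent_map f x) = 0%VS) ->
  open U -> smooth_vf_on U X ->
  (forall x, U (f x) -> tangent_map f x (Y x) = X (f x)) ->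
  smooth_vf_on (f @^-1` U) Y.
Proof.
move=> sf f_imm oU sX YX; have [cf _] := sf.
have oV : open (f @^-1` U) by apply: open_comp => // ? _; exact: cf.
apply/smooth_vf_onP => // x Ux; exists (chart_at x).
have ac := chart_at_atlas x; have cx := chart_at_dom x.
split=> //; set y0 := cmap _ x; pose J := jacobian (chart_rep f x).
have sJ : smooth_at y0 J by exact/smooth_jacobian/smooth_chart_rep.
have [C JC] : exists C, J y0 *m C = 1%:M.
  apply: left_invertible_rows => v; rewrite mul_jacobian -tangent_mapE => fv0.
  by apply/eqP; rewrite -memv0 -(f_imm x) memv_ker fv0.
have sJC : smooth_at y0 (fun y => J y *m C).
  by apply: smooth_mulmx => //; apply: smooth_cst.
have uJC : J y0 *m C \in unitmx by rewrite JC unitmx1.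
pose xi := vf_in_chart (chart_at (f x)) X.
apply: (smooth_near_eq
    (f := fun y => (xi \o chart_rep f x) y *m C *m invmx (J y *m C))).
  have unit_near := near_unitmx (A := fun y => J y *m C) uJC sJC.
  have rep_near := near_chart_rep sf (open_nbhs_nbhs (conj oU Ux)).
  apply: filterS2 unit_near rep_near => y uy [cy yE dy Uy /(_ Y)].
  rewrite YX // => YE.
  have -> : (xi \o chart_rep f x) y = pushed_vf f x Y y.
    by rewrite -YE /xi /chart_rep /= vf_in_chartE.
  by rewrite /pushed_vf -(mulmxA _ (jacobian _ _)) mulmxK.
have six : smooth_at y0 (xi \o chart_rep f x).
  apply: smooth_comp; first exact: smooth_chart_rep.
  rewrite chart_rep_center; apply: smooth_vf_on_at oU sX Ux _ _.
    exact: chart_at_atlas.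
  exact: chart_at_dom.
apply: smooth_mulmx; last exact: (smooth_invmx (A := fun y => J y *m C)).
by apply: smooth_mulmx => //; apply: smooth_cst.
Qed.

Lemma regular_pullback f (D : distribution N) :
  smooth_map f -> (forall x, lker (tangent_map f x) = 0%VS) ->
  (forall x, (D (f x) <= limg (tangent_map f x))%VS) ->
  regular_distribution D -> regular_distribution (pullback_distribution f D).
Proof.
move=> sf f_imm Df [k rD]; have [cf _] := sf; exists k => x.
have [U [X [oU Ux sX bX]]] := rD (f x).
(* The frame of [D] is lifted through the differential of [f], whose image contains [D]; the lift is
   unique by injectivity. *)
pose Y i z := (tangent_map f z)^-1%VF (X i (f z)).
have fY i z : U (f z) -> tangent_map f z (Y i z) = X i (f z).
  move=> Uz; rewrite /Y limg_lfunVK //; apply: (subvP (Df z)).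
  by have [-> _ _] := basis_of_family (bX _ Uz).
exists (f @^-1` U), Y; split=> //.
- by apply: open_comp => // ? _; exact: cf.
- by move=> i; apply: smooth_vf_pullback (sX i) _ => // z; apply: fY.
move=> z Uz; set g := tangent_map f z.
have gY : map g [seq Y i z | i : 'I_k] = [seq X i (f z) | i : 'I_k].
  by rewrite /image_mem -map_comp; apply: eq_map => i; apply: fY.
have gD : (g @: pullback_distribution f D z = D (f z))%VS.
  by rewrite lpreimK // /g; exact: Df.
have gspan : <<[seq Y i z | i : 'I_k]>>%VS = pullback_distribution f D z.
  have /andP[/eqP XD _] := bX _ Uz.
  have f_inj : lker g == 0%VS by rewrite f_imm.
  apply/eqP; rewrite -(eq_limg_ker0 _ _ f_inj).
  by rewrite limg_span gY XD gD.
(* The lifted family spans; it remains to count dimensions, which the injective [g] preserves. *)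
rewrite basisEdim gspan subvv /=.
have := bX _ Uz; rewrite basisEdim => /andP[_].
by rewrite -gD limg_dim_eq ?f_imm ?capv0 // !size_image.
Qed.

(* The second derivatives of the chart representation of [f] cancel by
   symmetry. *)
Lemma tangent_map_lie_bracket f U X Y x : smooth_map f ->
  open U -> U x -> smooth_vf_on U X -> smooth_vf_on U Y ->
  tangent_map f x (lie_bracket X Y x) =
  'd (pushed_vf f x Y) (cmap (chart_at x) x) (X x) -
  'd (pushed_vf f x X) (cmap (chart_at x) x) (Y x).
Proof.
move=> sf oU Ux sX sY; set y0 := cmap _ x; set g := chart_rep f x.
have sg : smooth_at y0 g by apply: smooth_chart_rep.
have dJ : differentiable (jacobian g) y0.
  exact/smooth_differentiable/smooth_jacobian.
have ac := chart_at_atlas x; have cx := chart_at_dom x.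
have pushE Z w : smooth_vf_on U Z -> 'd (pushed_vf f x Z) y0 w =
    tangent_map f x ('d (vf_in_chart (chart_at x) Z) y0 w) +
    'd (fun y => 'd g y (Z x)) y0 w.
  move=> sZ; have dZ : differentiable (vf_in_chart (chart_at x) Z) y0.
    exact: smooth_differentiable (smooth_vf_on_at oU sZ Ux ac cx).
  apply: etrans (diff_mulmx w dZ dJ) _.
  congr (_ + _); first by rewrite mul_jacobian tangent_mapE.
  have -> : vf_in_chart (chart_at x) Z y0 = Z x.
    by rewrite vf_in_chartE // tcoord_chart_at.
  have dgE : (fun y => 'd g y (Z x)) = (fun y => Z x *m jacobian g y).
    by apply/funext => y; rewrite mul_jacobian.
  rewrite dgE; apply/esym.
  apply: etrans (diff_mulmx w (differentiable_cst (Z x) y0) dJ) _.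
  have -> : 'd (cst (Z x)) y0 w = 0 := congr1 (@^~ w) (diff_cst (Z x) y0).
  by rewrite mul0mx add0r.
apply: etrans (esym (f_equal2 (fun a b => a - b) (pushE Y (X x) sY)
  (pushE X (Y x) sX))).
have dgC := diff_diffC_mx (Y x) (X x) sg.
have subKD (a b p q : 'rV[R]_n) : p = q -> a - b = (a + p) - (b + q).
  by move=> ->; rewrite opprD addrACA subrr addr0.
apply: etrans (subKD _ _ _ _ dgC).
by rewrite /lie_bracket linearB.
Qed.

Lemma involutive_pullback f (D : distribution N) :
  smooth_map f -> regular_distribution D -> Defs.involutive D ->
  Defs.involutive (pullback_distribution f D).
Proof.
move=> sf rD iD U X Y oU [sX XD] [sY YD] x Ux.
have ad := chart_at_atlas (f x); have dfx := chart_at_dom (f x).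
have [V [P [oV Vfx Vd PD]]] := regular_projector rD ad dfx.
set y0 := cmap (chart_at x) x; set z0 := cmap (chart_at (f x)) (f x).
have sP : smooth_at z0 P := smooth_projector Vfx PD.
have sg : smooth_at y0 (chart_rep f x) by exact: smooth_chart_rep.
(* The Leibniz rule for the identity between [pushed_vf f x Z] and its product with
   [P \o chart_rep f x], which holds near the centre because [Z] is tangent to the pullback of
   [D]. *)
have pushP Z w : smooth_vf_on U Z ->
    (forall z, U z -> Z z \in pullback_distribution f D z) ->
    'd (pushed_vf f x Z) y0 w = 'd (pushed_vf f x Z) y0 w *m P z0 +
      tangent_map f x (Z x) *m 'd P z0 (tangent_map f x w).
  move=> sZ ZD.
  have dZ := smooth_differentiable (smooth_pushed_vf sf oU Ux sZ).
  have dPg : differentiable (P \o chart_rep f x) y0.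
    apply: differentiable_comp; first exact: smooth_differentiable.
    by rewrite chart_rep_center; exact: smooth_differentiable.
  have gE := chart_rep_center f x.
  have dPgE : 'd (P \o chart_rep f x) y0 w = 'd P z0 (tangent_map f x w).
    rewrite tangent_mapE.
    have dP : differentiable P (chart_rep f x y0).
      by rewrite gE; exact: smooth_differentiable.
    apply: etrans (congr1 (@^~ w) (diff_comp (smooth_differentiable sg) dP)) _.
    exact: (congr1 (fun z => 'd P z ('d (chart_rep f x) y0 w)) gE).
  have := diff_mulmx w dZ dPg; rewrite dPgE -pushed_vf_center /= gE => <-.
  apply: diff_near_eq => //.
  have VU := near_chart_rep sf (open_nbhs_nbhs (conj oV Vfx)).
  have Un := near_cinv (chart_at_dom x) (open_nbhs_nbhs (conj oU Ux)).
  apply: filterS2 VU Un => y [cy yE dy Vy pE] [_ _ Uy].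
  have [_ _ PDy] := PD _ Vy; rewrite -pE /chart_rep /= PDy //.
  by have := ZD _ Uy; rewrite -memv_preim.
rewrite -memv_preim (tangent_map_lie_bracket sf oU Ux sX sY) -/y0.
have XDx : tangent_map f x (X x) \in D (f x).
  by have := XD _ Ux; rewrite -memv_preim.
have YDx : tangent_map f x (Y x) \in D (f x).
  by have := YD _ Ux; rewrite -memv_preim.
(* The terms with ['d P] cancel in the bracket by [involutive_projector]; what is left is fixed by
   [P], hence lies in [D]. *)
have fixP (a b p q : 'rV[R]_n) :
    a = a *m P z0 + p -> b = b *m P z0 + q -> p = q -> a - b = (a - b) *m P z0.
  move=> aE bE pq; rewrite {1}aE {1}bE pq mulmxBl.
  by rewrite opprD addrACA subrr addr0.
rewrite (fixP _ _ _ _ (pushP Y (X x) sY YD) (pushP X (Y x) sX XD)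
  (involutive_projector iD oV Vfx Vd PD XDx YDx)).
exact: (mem_projector Vfx PD).
Qed.

End Pullback.

(** * Pullback of leafwise forms *)

Section GramMatrices.
Context {R : realType}.

Definition bform n (G : 'M[R]_n) (u v : 'rV[R]_n) : R := (u *m G *m v^T) 0 0.

Lemma bformDl n (G : 'M[R]_n) u u' v :
  bform G (u + u') v = bform G u v + bform G u' v.
Proof. by rewrite /bform !mulmxDl mxE. Qed.

Lemma bform0l n (G : 'M[R]_n) v : bform G 0 v = 0.
Proof. by rewrite /bform !mul0mx mxE. Qed.

Lemma bform0r n (G : 'M[R]_n) u : bform G u 0 = 0.
Proof. by rewrite /bform trmx0 mulmx0 mxE. Qed.

Lemma bformNl n (G : 'M[R]_n) u v : bform G (- u) v = - bform G u v.
Proof. by rewrite /bform !mulNmx mxE. Qed.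

Lemma bformC n (G : 'M[R]_n) u v : G^T = - G -> bform G u v = - bform G v u.
Proof.
move=> GT; rewrite /bform -[in LHS](trmxK (u *m G *m v^T)) mxE.
by rewrite !trmx_mul trmxK GT mulNmx mulmxN mulmxA mxE.
Qed.

Lemma bformE n (G : 'M[R]_n) u v :
  bform G u v = \sum_a u 0 a * (\sum_b v 0 b * G a b).
Proof.
rewrite /bform -mulmxA mxE; apply: eq_bigr => a _; rewrite mxE; congr (_ * _).
by apply: eq_bigr => b _; rewrite mxE mulrC.
Qed.

(* The Koszul expression of [G] at [x0, x1, x2], where [aij] stands for the
   derivative of the [i]-th vector field along the [j]-th one. *)
Lemma koszul_cancel n (G dG0 dG1 dG2 : 'M[R]_n)
    (x0 x1 x2 a01 a02 a10 a12 a20 a21 : 'rV[R]_n) :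
  G^T = - G ->
  bform dG0 x1 x2 - bform dG1 x0 x2 + bform dG2 x0 x1 = 0 ->
  (bform G a10 x2 + bform dG0 x1 x2 + bform G x1 a20)
  - (bform G a01 x2 + bform dG1 x0 x2 + bform G x0 a21)
  + (bform G a02 x1 + bform dG2 x0 x1 + bform G x0 a12)
  - bform G (a10 - a01) x2 + bform G (a20 - a02) x1
  - bform G (a21 - a12) x0 = 0.
Proof.
move=> GT dG; rewrite !bformDl !bformNl -[RHS]dG.
by rewrite (bformC x1 a20 GT) (bformC x0 a21 GT) (bformC x0 a12 GT); ring.
Qed.

Lemma differentiable_trmx (V : normedModType R) p q (A : V -> 'M[R]_(p, q)) x :
  differentiable A x -> differentiable (fun y => (A y)^T) x.
Proof.
move=> /differentiable_mxP dA; apply/differentiable_mxP => i j.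
have -> : (fun y => (A y)^T i j) = (fun y => A y j i).
  by apply/funext => y; rewrite mxE.
exact: dA.
Qed.

Lemma diff_trmx (V : normedModType R) p q (A : V -> 'M[R]_(p, q)) x v :
  differentiable A x -> 'd (fun y => (A y)^T) x v = ('d A x v)^T.
Proof.
move=> dA; apply/matrixP => i j; rewrite [RHS]mxE.
apply: etrans (esym (diff_entry v i j (differentiable_trmx dA))) _.
apply: etrans (diff_entry v j i dA); congr ('d _ _ _).
by apply/funext => y; rewrite mxE.
Qed.

Lemma smooth_trmx (V : normedModType R) p q (A : V -> 'M[R]_(p, q)) x :
  smooth_at x A -> smooth_at x (fun y => (A y)^T).
Proof.
move=> /smooth_mxP sA; apply/smooth_mxP => i j.
by apply: smooth_eq (sA j i) => y; rewrite mxE.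
Qed.

Lemma smooth_bform (V : normedModType R) n (G : V -> 'M[R]_n) A B x :
  smooth_at x G -> smooth_at x A -> smooth_at x B ->
  smooth_at x (fun y => bform (G y) (A y) (B y)).
Proof.
move=> sG sA sB.
have /smooth_mxP := smooth_mulmx (smooth_mulmx sA sG) (smooth_trmx sB).
exact.
Qed.

Lemma diff_bform (V : normedModType R) n (G : V -> 'M[R]_n) A B x w :
  differentiable G x -> differentiable A x -> differentiable B x ->
  'd (fun y => bform (G y) (A y) (B y)) x w =
  bform (G x) ('d A x w) (B x) + bform ('d G x w) (A x) (B x) +
  bform (G x) (A x) ('d B x w).
Proof.
move=> dG dA dB; have dAG := differentiable_mulmx dA dG.
have dBT := differentiable_trmx dB.
apply: etrans (diff_entry w 0 0 (differentiable_mulmx dAG dBT)) _.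
apply: etrans (congr1 (fun M : 'M_(1, 1) => M 0 0) (diff_mulmx w dAG dBT)) _.
apply: etrans (f_equal2 (fun (M : 'M_(1, n)) (N : 'M_(n, 1)) =>
  (M *m (B x)^T + A x *m G x *m N) 0 0) (diff_mulmx w dA dG)
  (diff_trmx w dB)) _.
by rewrite mulmxDl [LHS]mxE [X in X + _]mxE.
Qed.

End GramMatrices.

(** * The Gram matrix of a leafwise form *)

Section LeafwiseForms.
Context {R : realType} {n : nat} {N : manifold R n}.
Context {TF : distribution N} {Om : N -> 'rV[R]_n -> 'rV[R]_n -> R}.
Hypothesis two_form : leafwise_two_form TF Om.

Lemma leafwise_form0l z v : v \in TF z -> Om z 0 v = 0.
Proof using two_form.
case: two_form => lin _ _ vTF.
(* Linearity at [a = -1] and two zero vectors reads [Om z 0 v = - Om z 0 v + Om z 0 v]. *)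
have := lin z (-1) 0 0 v; rewrite mem0v scaler0 add0r mulN1r addNr.
exact.
Qed.

Lemma leafwise_form_sum z (I : finType) (a : I -> R) (u : I -> 'rV[R]_n) v :
  (forall i, u i \in TF z) -> v \in TF z ->
  Om z (\sum_i a i *: u i) v = \sum_i a i * Om z (u i) v.
Proof using two_form.
case: two_form => lin _ _ uTF vTF.
(* [Om] is linear on [TF] only, so the induction also keeps the partial sums in [TF]. *)
suff [] : \sum_i a i *: u i \in TF z /\
    Om z (\sum_i a i *: u i) v = \sum_i a i * Om z (u i) v by [].
elim: (index_enum I) => [|i r [sTF IH]].
  by rewrite !big_nil mem0v leafwise_form0l.
by rewrite !big_cons lin // IH memvD ?memvZ.
Qed.

Context {z0 : N} {V : set N} {P : 'rV[R]_n -> 'M[R]_n}.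
Local Notation d := (chart_at z0).
Hypotheses (oV : open V) (Vz0 : V z0) (Vd : V `<=` cdom d).
Hypothesis PD : chart_projector TF d V P.
Let ad : atlas d := chart_at_atlas z0.
Local Notation sec := (projected_section d P).

(** Formed on the projected coordinate vectors rather than on a frame of [TF]: it has size [n]
    whatever the rank of [TF], and applies directly to chart coordinates. *)
Definition gram_matrix (y : 'rV[R]_n) : 'M[R]_n :=
  \matrix_(a, b) Om (cinv d y) (sec (delta_mx 0 a) (cinv d y))
                                (sec (delta_mx 0 b) (cinv d y)).

Lemma projected_section_mem z u : V z -> sec u z \in TF z.
Proof using PD. by move=> Vz; have [_ Pz _] := PD Vz; apply: Pz. Qed.

Lemma projected_section_tcoord z u :
  V z -> u \in TF z -> sec (tcoord d z u) z = u.
Proof using PD Vd ad.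
move=> Vz uTF; have [_ _ PDz] := PD Vz.
by rewrite /projected_section /lift_vf PDz // tcoordK //; exact: Vd.
Qed.

Lemma form_projected_section z u v : V z ->
  Om z (sec u z) (sec v z) = bform (gram_matrix (cmap d z)) u v.
Proof using PD Vd two_form.
move=> Vz; have dz := Vd Vz; have mem w := projected_section_mem w Vz.
have secE w : sec w z = \sum_a w 0 a *: sec (delta_mx 0 a) z.
  rewrite {1}[w]row_sum_delta /projected_section /lift_vf mulmx_suml linear_sum.
  by apply: eq_bigr => a _; rewrite -scalemxAl linearZ.
case: two_form => _ anti _.
rewrite {1}secE leafwise_form_sum // bformE; apply: eq_bigr => a _.
(* Linearity in the second argument is obtained from the first by using antisymmetry twice. *)
congr (_ * _); rewrite anti // {1}secE leafwise_form_sum // -sumrN.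
apply: eq_bigr => b _; rewrite /gram_matrix mxE cmapK // -mulrN.
by rewrite -anti.
Qed.

Lemma gram_matrix_form z u v : V z -> u \in TF z -> v \in TF z ->
  Om z u v = bform (gram_matrix (cmap d z)) (tcoord d z u) (tcoord d z v).
Proof using PD Vd ad two_form.
move=> Vz uTF vTF; rewrite -form_projected_section //.
by rewrite !projected_section_tcoord.
Qed.

Lemma gram_matrix_trmx z : V z ->
  (gram_matrix (cmap d z))^T = - gram_matrix (cmap d z).
Proof using PD Vd two_form.
move=> Vz; apply/matrixP => a b; rewrite !mxE cmapK; last exact: Vd.
by case: two_form => _ anti _; apply: anti; exact: projected_section_mem.
Qed.

Lemma smooth_gram_matrix : smooth_at (cmap d z0) gram_matrix.
Proof using PD Vd Vz0 ad oV two_form.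
apply/smooth_mxP => a b.
have lP u := local_projected_section u ad oV Vd PD.
case: two_form => _ _ /(_ V _ _ oV (lP (delta_mx 0 a)) (lP (delta_mx 0 b))).
move=> /(smooth_fun_onP _ oV)/(_ z0 Vz0).
by apply: smooth_eq => y; rewrite mxE.
Qed.

(** The Koszul formula for the projected sections of [t0], [t1], [t2]: these take the values [t0],
    [t1], [t2] at [z0] and their brackets vanish there, so only derivatives of the form survive. *)
Lemma gram_matrix_closed t0 t1 t2 :
  Defs.involutive TF -> leafwise_closed TF Om ->
  t0 \in TF z0 -> t1 \in TF z0 -> t2 \in TF z0 ->
  let dG := 'd gram_matrix (cmap d z0) in
  bform (dG t0) t1 t2 - bform (dG t1) t0 t2 + bform (dG t2) t0 t1 = 0.
Proof using PD Vd Vz0 ad oV two_form.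
move=> iTF cOm t0TF t1TF t2TF dG.
have dGz := smooth_differentiable smooth_gram_matrix.
have lP u := local_projected_section u ad oV Vd PD.
(* In the chart, [sec u] and [sec v] are represented by the constant vectors [u] and [v], so only
   the Gram matrix is differentiated. *)
have derivE u v w : w \in TF z0 ->
    vf_deriv (sec w) (fun z => Om z (sec u z) (sec v z)) z0 = bform (dG w) u v.
  move=> wTF; rewrite /vf_deriv (projected_section_center Vz0 PD wTF).
  have dF := diff_bform w dGz (differentiable_cst u _) (differentiable_cst v _).
  apply: etrans (etrans dF _).
    apply/esym; apply: diff_near_eq.
      have VP := near_cinv (chart_at_dom z0) (open_nbhs_nbhs (conj oV Vz0)).
      apply: filterS VP.
      by move=> y [cy yE Vy]; rewrite /= form_projected_section // yE.
    by have /smooth_differentiable := smooth_bform smooth_gram_matrix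
      (smooth_cst u _) (smooth_cst v _).
  have d0 (a : 'rV[R]_n) : 'd (cst a) (cmap d z0) w = 0.
    exact: (congr1 (@^~ w) (diff_cst a _)).
  apply: etrans (f_equal2 (fun a b => bform _ a v + bform (dG w) u v +
    bform _ u b) (d0 u) (d0 v)) _.
  by rewrite bform0l bform0r add0r addr0.
have br0 := lie_bracket_projected_section0 iTF oV Vz0 Vd PD.
have := cOm V (sec t0) (sec t1) (sec t2) oV (lP t0) (lP t1) (lP t2) z0 Vz0.
rewrite /leafwise_d !derivE // !br0 // !(projected_section_center Vz0 PD) //.
by rewrite !leafwise_form0l // !subr0 addr0.
Qed.

End LeafwiseForms.

(** * Pullback along a map whose differential has image [TF] *)

Section PullbackForms.
Context {R : realType} {m n : nat} {M : manifold R m} {N : manifold R n}.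
Context {TF : distribution N} {Om : N -> 'rV[R]_n -> 'rV[R]_n -> R}.
Context {f : M -> N}.
Hypotheses (rTF : regular_distribution TF) (two_form : leafwise_two_form TF Om).
Hypotheses (sf : smooth_map f).
Hypothesis limg_f : forall x, limg (tangent_map f x) = TF (f x).

Lemma tangent_map_mem x v : tangent_map f x v \in TF (f x).
Proof using limg_f. by rewrite -limg_f memv_img ?memvf. Qed.

Section AtPoint.
Context {x : M} {V : set N} {P : 'rV[R]_n -> 'M[R]_n}.
Local Notation c := (chart_at x).
Local Notation y0 := (cmap c x).
Hypotheses (oV : open V) (Vfx : V (f x)) (Vd : V `<=` cdom (chart_at (f x))).
Hypothesis PD : chart_projector TF (chart_at (f x)) V P.
Local Notation G := (@gram_matrix R n N Om (f x) P \o chart_rep f x).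

(** Writes the pulled back form through functions on the chart of the source, to which
    [smooth_bform] and [diff_bform] apply. *)
Lemma near_pullback_form X Y : \forall y \near y0,
  bform (G y) (pushed_vf f x X y) (pushed_vf f x Y y) =
  pullback_form f Om (cinv c y) (X (cinv c y)) (Y (cinv c y)).
Proof using two_form sf limg_f oV Vfx Vd PD.
apply: filterS (near_chart_rep sf (open_nbhs_nbhs (conj oV Vfx))).
move=> y [cy yE dy Vy pE]; rewrite /pullback_form /chart_rep /=.
by rewrite (gram_matrix_form two_form Vd PD Vy) ?tangent_map_mem // !pE.
Qed.

Lemma smooth_pullback_gram : smooth_at y0 G.
Proof using two_form sf oV Vfx Vd PD.
apply: smooth_comp; first exact: smooth_chart_rep.
by rewrite chart_rep_center; exact: (smooth_gram_matrix two_form oV Vfx Vd PD).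
Qed.

Lemma pullback_form_center u v : pullback_form f Om x u v =
  bform (G y0) (tangent_map f x u) (tangent_map f x v).
Proof using two_form limg_f Vfx Vd PD.
rewrite /pullback_form /= chart_rep_center.
rewrite (gram_matrix_form two_form Vd PD Vfx) ?tangent_map_mem //.
by rewrite !tcoord_chart_at.
Qed.

(** The Leibniz rule in three factors; the chain rule turns the derivative of [G] along [w] into one
    of the Gram matrix along the image of [w]. *)
Lemma vf_deriv_pullback_form U X Y w : open U -> U x ->
  smooth_vf_on U X -> smooth_vf_on U Y ->
  'd ((fun z => pullback_form f Om z (X z) (Y z)) \o cinv c) y0 w =
  bform (G y0) ('d (pushed_vf f x X) y0 w) (tangent_map f x (Y x)) +
  bform ('d (@gram_matrix R n N Om (f x) P) (cmap (chart_at (f x)) (f x))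
    (tangent_map f x w)) (tangent_map f x (X x)) (tangent_map f x (Y x)) +
  bform (G y0) (tangent_map f x (X x)) ('d (pushed_vf f x Y) y0 w).
Proof using two_form sf limg_f oV Vfx Vd PD.
move=> oU Ux sX sY; have sG := smooth_pullback_gram.
have sXp := smooth_pushed_vf sf oU Ux sX.
have sYp := smooth_pushed_vf sf oU Ux sY.
have dF := smooth_differentiable (smooth_bform sG sXp sYp).
apply: etrans (esym (diff_near_eq w (near_pullback_form X Y) dF)) _.
have dG := smooth_differentiable sG.
have dXp := smooth_differentiable sXp; have dYp := smooth_differentiable sYp.
apply: etrans (diff_bform w dG dXp dYp) _.
rewrite !pushed_vf_center; congr (_ + bform _ _ _ + _).
have dg := smooth_differentiable (smooth_chart_rep x sf).
have gE := chart_rep_center f x.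
have dGf : differentiable (@gram_matrix R n N Om (f x) P) (chart_rep f x y0).
  rewrite gE; apply/smooth_differentiable.
  exact: (smooth_gram_matrix two_form oV Vfx Vd PD).
apply: etrans (congr1 (@^~ w) (diff_comp dg dGf)) _.
rewrite tangent_mapE.
exact: (congr1 (fun z => 'd (@gram_matrix R n N Om (f x) P) z
  ('d (chart_rep f x) y0 w)) gE).
Qed.

End AtPoint.

Lemma two_form_pullback :
  leafwise_two_form (@tangent_distribution R m M) (pullback_form f Om).
Proof using rTF two_form sf limg_f.
case: (two_form) => lin anti _; split=> [z a u u' v _ _ _|z u v _ _|].
- by rewrite /pullback_form linearP lin ?tangent_map_mem.
- by rewrite /pullback_form anti ?tangent_map_mem.
move=> U X Y oU [sX _] [sY _]; apply/smooth_fun_onP => // x Ux.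
have [V [P [oV Vfx Vd PD]]] :=
  regular_projector rTF (chart_at_atlas (f x)) (chart_at_dom (f x)).
apply: smooth_near_eq (near_pullback_form oV Vfx Vd PD X Y) _.
apply: smooth_bform; first exact: (smooth_pullback_gram oV Vfx Vd PD).
  exact: (smooth_pushed_vf sf oU Ux sX).
exact: (smooth_pushed_vf sf oU Ux sY).
Qed.

(** Every vector of [TF] at [f x] is an image, so the image of [u] is tested against all of [TF] and
    vanishes; injectivity concludes. *)
Lemma nondegenerate_pullback : (forall x, lker (tangent_map f x) = 0%VS) ->
  leafwise_nondegenerate TF Om ->
  leafwise_nondegenerate (@tangent_distribution R m M) (pullback_form f Om).
Proof using limg_f.
move=> f_imm ndOm x u _ u0; apply/eqP; rewrite -memv0 -(f_imm x) memv_ker.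
apply/eqP/(ndOm (f x)) => [|v]; first exact: tangent_map_mem.
by rewrite -limg_f => /memv_imgP[w _ ->]; apply: u0; exact: memvf.
Qed.

(* All the first derivatives of the vector fields cancel, so that the Koszul
   expression of the pullback is the exterior derivative of the Gram matrix. *)
Lemma closed_pullback : Defs.involutive TF -> leafwise_closed TF Om ->
  leafwise_closed (@tangent_distribution R m M) (pullback_form f Om).
Proof using rTF two_form sf limg_f.
move=> iTF cOm U X0 X1 X2 oU [s0 _] [s1 _] [s2 _] x Ux.
have [V [P [oV Vfx Vd PD]]] :=
  regular_projector rTF (chart_at_atlas (f x)) (chart_at_dom (f x)).
have fD := @tangent_map_mem x.
have dG0 := gram_matrix_closed two_form oV Vfx Vd PD iTF cOm
  (fD (X0 x)) (fD (X1 x)) (fD (X2 x)).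
have GT : let G := @gram_matrix R n N Om (f x) P in
    let z := chart_rep f x (cmap (chart_at x) x) in (G z)^T = - G z.
  by rewrite /= chart_rep_center (gram_matrix_trmx two_form Vd PD Vfx).
have brE X Y w : smooth_vf_on U X -> smooth_vf_on U Y ->
    pullback_form f Om x (lie_bracket X Y x) w = bform _ _ _ :=
  fun sX sY => etrans (pullback_form_center Vfx Vd PD _ w)
    (congr1 (fun u => bform _ u _) (tangent_map_lie_bracket sf oU Ux sX sY)).
apply: etrans (koszul_cancel _ _ _ _ _ _ GT dG0); rewrite /leafwise_d.
have derivE := vf_deriv_pullback_form oV Vfx Vd PD.
congr (_ - _ + _ - _ + _ - _).
- exact: (derivE _ _ _ _ oU Ux s1 s2).
- exact: (derivE _ _ _ _ oU Ux s0 s2).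
- exact: (derivE _ _ _ _ oU Ux s0 s1).
- exact: (brE _ _ _ s0 s1).
- exact: (brE _ _ _ s0 s2).
- exact: (brE _ _ _ s1 s2).
Qed.

End PullbackForms.

(** * Polarizations of the leaves *)

Lemma polarization_pullback (R : realType) (m n : nat) (F : manifold R m)
    (Z : manifold R n) (TF T : distribution Z)
    (Om : Z -> 'rV[R]_n -> 'rV[R]_n -> R) (f : F -> Z) :
  smooth_map f -> (forall p, lker (tangent_map f p) = 0%VS) ->
  (forall p, limg (tangent_map f p) = TF (f p)) ->
  polarization TF Om T ->
  symplectic_manifold_polarization (pullback_form f Om)
    (pullback_distribution f T).
Proof.
move=> sf f_imm limg_f [rT iT TTF isoT maxT]; split.
- by apply: regular_pullback => // p; rewrite limg_f.
- exact: involutive_pullback.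
- by move=> p; exact: subvf.
- by move=> p u v; rewrite -!memv_preim; exact: isoT.
(* Maximality: the image of [W] is isotropic and lies between [T] and [TF], hence equals [T], which
   is also the image of the pullback; the injective differential reflects this equality. *)
move=> p W TW _ isoW.
have f_inj : lker (tangent_map f p) == 0%VS by rewrite f_imm.
have Tf : (tangent_map f p @: pullback_distribution f T p)%VS = T (f p).
  by rewrite lpreimK // limg_f.
apply/eqP; rewrite -(eq_limg_ker0 _ _ f_inj) Tf; apply/eqP/maxT.
- by rewrite -Tf limgS.
- by rewrite -limg_f limgS // subvf.
- by move=> _ _ /memv_imgP[u uW ->] /memv_imgP[v vW ->]; exact: isoW.
Qed.

Theorem proposition10 (R : realType) (n : nat) (Z : manifold R n)
    (TF : distribution Z) (Om : Z -> 'rV[R]_n -> 'rV[R]_n -> R)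
    (T : distribution Z) :
  symplectic_foliation TF Om ->
  polarization TF Om T ->
  forall (m : nat) (F : manifold R m) (i : F -> Z),
    leaf TF i ->
    [/\ forall p, pullback_distribution i TF p = tangent_distribution p,
        symplectic_manifold (pullback_form i Om) &
        symplectic_manifold_polarization (pullback_form i Om)
          (pullback_distribution i T)].
Proof.
move=> [[rTF iTF] two_form nd_Om closed_Om] polT m F i.
move=> [[_ [si i_imm] limg_i] _].
have TFE p : pullback_distribution i TF p = tangent_distribution p.
  by apply/vspaceP => v; rewrite -memv_preim memvf -limg_i memv_img // memvf.
split=> //; last exact: polarization_pullback polT.
split.
- split; last by move=> *; exact: memvf.
  (* The tangent distribution of the leaf is the pullback of [TF], so its regularity is an instance
     of [regular_pullback]. *)
  rewrite -(funext TFE); apply: regular_pullback => // p.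
  by rewrite limg_i.
- exact: (two_form_pullback rTF).
- exact: nondegenerate_pullback.
- exact: (closed_pullback rTF).
Qed.
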